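(* Let $\mathcal{X}$ and $\mathcal{Y}$ be finite nonempty sets, let $M$ be a Markov transition matrix indexed by $\mathcal{X}\times\mathcal{X}$, and let $\mathcal{M}=\{M(y):y\in\mathcal{Y}\}$ be a family of entrywise nonnegative matrices indexed by $\mathcal{X}\times\mathcal{X}$ with $\sum_{y\in\mathcal{Y}}M(y)=M$. Let $\mathcal{M}^*$ be the set of all finite products of elements of $\mathcal{M}$, let $\mathcal{C}=\{cA: c>0,\ A\in\mathcal{M}^*\}$, and let $\overline{\mathcal{C}}$ be the closure of $\mathcal{C}$. Suppose $M$ is irreducible and suppose that $\overline{\mathcal{C}}$ contains an element of rank $1$. Then $T_{\mathcal{M}}$ has a unique stationary distribution $\lambda\in\mathcal{P}(\Delta)$, and for each $\mu\in\mathcal{P}(\Delta)$ one has $(T_{\mathcal{M}}^* )^n\mu\to\lambda$ weakly in Cesàro mean, i.e. $\frac1n\sum_{k=1}^{n}(T_{\mathcal{M}}^* )^k\mu\to\lambda$ weakly as $n\to\infty$. Suppose, in addition, that $M$ is aperiodic. Then $(T_{\mathcal{M}}^* )^n\mu\to\lambda$ weakly as $n\to\infty$, for each $\mu\in\mathcal{P}(\Delta)$.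
   Context: Let $s=|\mathcal{X}|$, and let $\Delta\subset\mathbb{R}^s$ be the simplex of probability measures on $\mathcal{X}$, viewed as row vectors, with the usual Euclidean topology. A Markov transition matrix is an entrywise nonnegative $s\times s$ matrix all of whose rows sum to $1$. Let $e$ be the column vector of length $s$ with all entries $1$. $C(\Delta)$ is the space of continuous real-valued functions on $\Delta$ with the sup norm, and $\mathcal{P}(\Delta)$ is the set of (Borel) probability measures on $\Delta$ with the weak topology. The closure $\overline{\mathcal{C}}$ is taken in the space of real $s\times s$ matrices with its usual topology. The matrix $M$ is irreducible if for every pair $(i,j)$ there is some $k$ (possibly depending on $(i,j)$) with $(M^k)_{ij}>0$. It is aperiodic if there is a single $k$ such that $(M^k)_{ij}>0$ for all $(i,j)$. The $\alpha$-chain associated with $\mathcal{M}$ is the Markov chain on $\Delta$ which moves from $\alpha\in\Delta$ to $\frac{\alpha M(y)}{\alpha M(y)e}$ with probability $\alpha M(y)e$, for $y\in\mathcal{Y}$. It is weak Feller, with Markov operator $T_{\mathcal{M}}:C(\Delta)\to C(\Delta)$ given by $$(T_{\mathcal{M}}f)(\alpha)=\sum_{y\in\mathcal{Y}}(\alpha M(y)e)\,f\!\left(\frac{\alpha M(y)}{\alpha M(y)e}\right),$$ where any term with $\alpha M(y)e=0$ is set equal to $0$. The adjoint $T_{\mathcal{M}}^*$ acts on $\mathcal{P}(\Delta)$ by $\int f\,d(T_{\mathcal{M}}^*\mu)=\int T_{\mathcal{M}}f\,d\mu$ for all $f\in C(\Delta)$; thus $(T_{\mathcal{M}}^* )^n\mu$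 is the law of the $\alpha$-chain at time $n$ when its initial law is $\mu$. A stationary distribution for $T_{\mathcal{M}}$ is a $\lambda\in\mathcal{P}(\Delta)$ with $T_{\mathcal{M}}^*\lambda=\lambda$. *)

(* Defs.v *)
From HB Require Import structures.
From mathcomp Require Import all_boot all_order all_algebra.
From mathcomp Require Import all_classical all_reals all_analysis.
From mathcomp Require Import measurable_realfun giry lra.

Set Implicit Arguments.
Unset Strict Implicit.
Unset Printing Implicit Defensive.

Import Order.TTheory GRing.Theory Num.Theory.
Import numFieldNormedType.Exports.

Local Open Scope classical_set_scope.
Local Open Scope ring_scope.

(* The finite state space is ['I_n.+1]: a finite nonempty set with its elements
   numbered, so that [s = n.+1] and measures on it are row vectors. *)

Section Matrices.
Context (R : realType) (n : nat).
Implicit Types A M : 'M[R]_n.+1.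

Definition nonneg_mx A := forall i j, 0 <= A i j.

Definition markov_mx M := nonneg_mx M /\ forall i, \sum_j M i j = 1.

Definition irreducible_mx M := forall i j, exists k, 0 < (M ^+ k) i j.

Definition aperiodic_mx M := exists k, forall i j, 0 < (M ^+ k) i j.

Definition mx_products (Y : finType) (Mf : Y -> 'M[R]_n.+1) : set 'M[R]_n.+1 :=
  [set \prod_(y <- w) Mf y | w in [set: seq Y]].

Definition mx_cone (Y : finType) (Mf : Y -> 'M[R]_n.+1) : set 'M[R]_n.+1 :=
  [set c *: A | c in [set c : R | 0 < c] & A in mx_products Mf].

End Matrices.

Section Simplex.
Context (R : realType) (n : nat).

Definition simplex : set 'rV[R]_n.+1 :=
  [set a | (forall i, 0 <= a 0 i) /\ \sum_i a 0 i = 1].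

Lemma simplex_delta0 : simplex (delta_mx 0 0).
Proof.
split=> [i|]; first by rewrite mxE; case: (_ && _).
by rewrite (bigD1 ord0)//= mxE !eqxx big1 ?addr0// => i /negPf i0; rewrite mxE i0 andbF.
Qed.

(* Subtype with the subspace topology and its Borel sigma-algebra; the library
   requires measurable types to be pointed, and the chosen point plays no role. *)
Definition Delta := set_type simplex.

HB.instance Definition _ := PseudoMetric.copy Delta (set_type simplex).
HB.instance Definition _ :=
  isPointed.Build Delta (exist _ (delta_mx 0 0) (mem_set simplex_delta0)).
HB.instance Definition _ :=
  Measurable.copy Delta (g_sigma_algebraType (@open Delta)).

End Simplex.

Section WeakConvergence.
Context (R : realType) (n : nat).
Local Notation Delta := (Delta R n).

Definition weak_cvg (mu_ : nat -> {measure set Delta -> \bar R})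
    (mu : {measure set Delta -> \bar R}) :=
  forall f : Delta -> R, continuous f ->
    (\int[mu_ k]_a f a) @[k --> \oo] --> \int[mu]_a f a.

(* The measure (mu_ 1 + ... + mu_ N) / N; it is zero for N = 0. *)
Definition cesaro_mean (mu_ : nat -> {measure set Delta -> \bar R}) (N : nat) :
    {measure set Delta -> \bar R} :=
  mscale (N%:R^-1)%:nng (msum (fun k => mu_ k.+1) N).

End WeakConvergence.

Section AlphaChain.
Context (R : realType) (n : nat) (Y : finType) (Mf : Y -> 'M[R]_n.+1).
Local Notation Delta := (Delta R n).

Definition alpha_weight (y : Y) (a : Delta) : R :=
  (val a *m Mf y *m const_mx 1 : 'M[R]_1) 0 0.

(* If the weight is [0] the vector below is [0], which is not in the simplex, and
   [insubd] returns the junk value [a]. *)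
Definition alpha_next (y : Y) (a : Delta) : Delta :=
  insubd a ((alpha_weight y a)^-1 *: (val a *m Mf y)).

Definition alpha_op (f : Delta -> R) (a : Delta) : R :=
  \sum_y alpha_weight y a * f (alpha_next y a).

(* [alpha_adjointP] below shows that the set is inhabited when the [Mf y] are
   nonnegative with a Markov sum, so the default [mu] is not used in that case.
   The condition determines [nu] on Borel sets. *)
Definition alpha_adjoint (mu : probability Delta R) : probability Delta R :=
  xget mu [set nu : probability Delta R | forall f : Delta -> R, continuous f ->
    \int[nu]_a f a = \int[mu]_a alpha_op f a].

(* Equality on measurable sets ([measure_eq]): a measure is a function on all sets
   and its values on nonmeasurable ones are meaningless. *)
Definition stationary (lambda : probability Delta R) : Prop :=
  alpha_adjoint lambda ≡μ lambda.

Lemma alpha_weightE y (a : Delta) : alpha_weight y a = \sum_j (val a *m Mf y) 0 j.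
Proof. by rewrite /alpha_weight mxE; apply: eq_bigr => j _; rewrite [X in _ * X]mxE mulr1. Qed.

Section adjoint_exists.
Hypothesis Mf_ge0 : forall y, nonneg_mx (Mf y).
Hypothesis Mf_markov : markov_mx (\sum_y Mf y).

Lemma Delta_ge0 (a : Delta) i : 0 <= val a 0 i.
Proof. by have := set_mem (valP a) => -[]. Qed.

Lemma Delta_sum1 (a : Delta) : \sum_i val a 0 i = 1.
Proof. by have := set_mem (valP a) => -[]. Qed.

Lemma alpha_step_ge0 y (a : Delta) j : 0 <= (val a *m Mf y) 0 j.
Proof.
by rewrite mxE sumr_ge0// => i _; rewrite mulr_ge0 ?Delta_ge0//; exact: Mf_ge0.
Qed.

Lemma alpha_weight_ge0 y a : 0 <= alpha_weight y a.
Proof. by rewrite alpha_weightE sumr_ge0// => j _; exact: alpha_step_ge0. Qed.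

Lemma alpha_weight_sum1 a : \sum_y alpha_weight y a = 1.
Proof.
under eq_bigr do rewrite alpha_weightE.
rewrite exchange_big/= -(Delta_sum1 a).
under eq_bigr do rewrite -summxE -mulmx_sumr mxE.
by rewrite exchange_big/=; apply: eq_bigr => i _; rewrite -mulr_sumr (proj2 Mf_markov) mulr1.
Qed.

Lemma val_alpha_next y (a : Delta) : alpha_weight y a != 0 ->
  val (alpha_next y a) = (alpha_weight y a)^-1 *: (val a *m Mf y).
Proof.
move=> w0; rewrite /alpha_next val_insubd ifT//; apply/mem_set; split=> [i|].
  by rewrite mxE mulr_ge0 ?invr_ge0 ?alpha_weight_ge0 ?alpha_step_ge0.
under eq_bigr do rewrite mxE.
by rewrite -mulr_sumr -alpha_weightE mulVf.
Qed.

Lemma alpha_next_id y a : alpha_weight y a = 0 -> alpha_next y a = a.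
Proof.
move=> w0; apply/val_inj; rewrite /alpha_next val_insubd.
rewrite w0 invr0 scale0r ifN//; apply/negP => /set_mem[_].
by rewrite big1 => [/esym/eqP|i _]; rewrite ?oner_eq0// mxE.
Qed.

Lemma continuous_val_Delta : continuous (val : Delta -> 'rV[R]_n.+1).
Proof. exact: initial_continuous. Qed.

Lemma continuous_coord_Delta i : continuous (fun a : Delta => val a 0 i).
Proof.
move=> a; apply: (@continuous_comp Delta _ _ val (fun v : 'rV[R]_n.+1 => v 0 i)).
  exact: continuous_val_Delta.
exact: coord_continuous.
Qed.

Lemma continuous_coord_step y j : continuous (fun a : Delta => (val a *m Mf y) 0 j).
Proof.
rewrite (_ : (fun a : Delta => _) = fun a => \sum_i (val a 0 i * Mf y i j)); last first.
  by apply/funext => a; rewrite mxE.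
apply: continuous_big => [|i _ a]; first exact: add_continuous.
by apply: (@cvgMr_tmp _ _ (nbhs a)); exact: continuous_coord_Delta.
Qed.

Lemma continuous_step y : continuous (fun a : Delta => val a *m Mf y).
Proof.
rewrite (_ : (fun a : Delta => _) = fun a => \sum_i (val a 0 i *: row i (Mf y))).
  apply: continuous_big => [|i _ a]; first exact: add_continuous.
  by apply: (@cvgZr_tmp _ _ _ (nbhs a)); exact: continuous_coord_Delta.
by apply/funext => a; rewrite mulmx_sum_row.
Qed.

Lemma continuous_alpha_weight y : continuous (alpha_weight y).
Proof.
rewrite (_ : alpha_weight y = fun a => \sum_j (val a *m Mf y) 0 j); last first.
  by apply/funext => a; rewrite alpha_weightE.
apply: continuous_big => [|j _]; first exact: add_continuous.
exact: continuous_coord_step.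
Qed.

Lemma continuous_measurable_Delta (f : Delta -> R) : continuous f -> measurable_fun setT f.
Proof.
move=> /continuousP cf; apply: (measurability _ (RGenOpens.measurableE R)).
move=> _ [_ [a [b ->] <-]]; rewrite setTI; apply: sub_sigma_algebra.
by apply: cf; exact: interval_open.
Qed.

Lemma measurable_alpha_next y : measurable_fun setT (alpha_next y).
Proof.
apply: (@measurability _ _ _ _ _ _ (@open Delta)) => //.
move=> _ [U oU <-]; rewrite setTI.
have [W oW WU] := oU.
pose D := [set a | alpha_weight y a != 0].
have oD : open D.
  rewrite (_ : D = alpha_weight y @^-1` [set x | x != 0]); last by [].
  by move/continuousP : (@continuous_alpha_weight y); apply; exact: open_neq.
have -> : alpha_next y @^-1` U = (~` D `&` U) `|`
    (D `&` [set a : Delta | W ((alpha_weight y a)^-1 *: (val a *m Mf y))]).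
  apply/seteqP; split=> [a /= Ua|a /=].
    have [w0|w0] := eqVneq (alpha_weight y a) 0.
      by left; split; [rewrite /D/= w0 eqxx|rewrite -(alpha_next_id w0)].
    by right; split => //=; rewrite -val_alpha_next//; rewrite -WU in Ua.
  move=> [[/negP]|[aD]].
    by rewrite negbK => /eqP /alpha_next_id ->.
  by rewrite -val_alpha_next// -WU.
apply: measurableU.
  apply: measurableI; last exact: sub_sigma_algebra.
  by apply: measurableC; exact: sub_sigma_algebra.
apply: sub_sigma_algebra; rewrite openE => a [aD Wa].
have : (fun b : Delta => (alpha_weight y b)^-1 *: (val b *m Mf y)) @ a -->
    (alpha_weight y a)^-1 *: (val a *m Mf y).
  apply: (@cvgZ _ _ _ (nbhs a)).
    by apply: (@cvgV _ _ (nbhs a)) => //; exact: continuous_alpha_weight.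
  exact: continuous_step.
move=> /(_ _ (open_nbhs_nbhs (conj oW Wa))) ?.
apply: filterI => //.
by apply: open_nbhs_nbhs; split.
Qed.

Section transition_kernel.
Variable y0 : Y.

Let m (a : Delta) (k : nat) : {measure set Delta -> \bar R} :=
  let y := nth y0 (enum Y) k in
  mscale (NngNum (alpha_weight_ge0 y a)) (\d_(alpha_next y a))%R.

Definition alpha_ker (a : Delta) : set Delta -> \bar R := msum (m a) #|Y|.

HB.instance Definition _ a := Measure.on (alpha_ker a).

Lemma alpha_kerE a A :
  alpha_ker a A = (\sum_y (alpha_weight y a)%:E * \d_(alpha_next y a) A)%E.
Proof.
by rewrite /alpha_ker /msum/= -[RHS]big_enum/= (big_nth y0) -cardE big_mkord.
Qed.

Let alpha_kerT a : alpha_ker a setT = 1%E.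
Proof.
rewrite alpha_kerE -(alpha_weight_sum1 a) -sumEFin.
by apply: eq_bigr => y _; rewrite diracT mule1.
Qed.

HB.instance Definition _ a :=
  Measure_isProbability.Build _ _ _ (alpha_ker a) (alpha_kerT a).

Definition alpha_giry (a : Delta) : giry Delta R := alpha_ker a.

Lemma measurable_alpha_giry : measurable_fun setT alpha_giry.
Proof.
apply: measurable_giry_codensity => // B mB.
rewrite (_ : (fun a => _) = fun a =>
    (\sum_y (alpha_weight y a * \1_B (alpha_next y a))%:E)%E); last first.
  apply/funext => a; rewrite [LHS]alpha_kerE.
  by apply: eq_bigr => y _; rewrite diracE EFinM indicE.
apply: emeasurable_sum => y; apply/measurable_EFinP/measurable_funM.
  exact: (continuous_measurable_Delta (@continuous_alpha_weight y)).
by apply: measurableT_comp => //; exact: measurable_alpha_next.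
Qed.

Lemma integral_alpha_ker a (g : Delta -> R) :
    measurable_fun setT g -> (forall b, 0 <= g b) ->
  (\int[alpha_ker a]_b (g b)%:E)%E = (alpha_op g a)%:E.
Proof.
move=> mg g0; rewrite ge0_integral_measure_sum//; last 2 first.
  by move=> b _; rewrite lee_fin.
  exact/measurable_EFinP.
rewrite /alpha_op -sumEFin -[RHS]big_enum/= (big_nth y0) -cardE big_mkord.
apply: eq_bigr => k _; rewrite ge0_integral_mscale//=; last 2 first.
  exact/measurable_EFinP.
  by move=> b _; rewrite lee_fin.
by rewrite integral_dirac// ?diracT ?mul1e//; exact/measurable_EFinP.
Qed.

Variable mu : probability Delta R.

Definition alpha_push : set Delta -> \bar R :=
  giry_bind (mu : giry Delta R) measurable_alpha_giry.

HB.instance Definition _ := Measure.on alpha_push.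

Lemma ge0_integral_alpha_push (g : Delta -> R) :
    measurable_fun setT g -> (forall b, 0 <= g b) ->
  (\int[alpha_push]_b (g b)%:E = \int[mu]_a (alpha_op g a)%:E)%E.
Proof.
move=> mg g0.
rewrite [LHS](@giry_int_bind _ _ _ _ _ mu _ measurable_alpha_giry (EFin \o g))//.
- by apply: eq_integral => a _; rewrite -integral_alpha_ker.
- exact/measurable_EFinP.
Qed.

Lemma alpha_op_cst c a : alpha_op (fun=> c) a = c.
Proof. by rewrite /alpha_op -mulr_suml alpha_weight_sum1 mul1r. Qed.

Let alpha_pushT : alpha_push setT = 1%E.
Proof.
have := @ge0_integral_alpha_push (fun=> 1) (measurable_cst _) (fun=> ler01).
under [in X in _ = X -> _]eq_integral do rewrite alpha_op_cst.
by rewrite !integral_cst// !mul1e => ->; exact: probability_setT.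
Qed.

HB.instance Definition _ :=
  Measure_isProbability.Build _ _ _ alpha_push alpha_pushT.

Lemma measurable_alpha_op (g : Delta -> R) :
  measurable_fun setT g -> measurable_fun setT (alpha_op g).
Proof.
move=> mg; apply: measurable_sum => y; apply: measurable_funM.
  exact: (continuous_measurable_Delta (@continuous_alpha_weight y)).
by apply: measurableT_comp => //; exact: measurable_alpha_next.
Qed.

End transition_kernel.

Lemma continuous_bounded_Delta (f : Delta -> R) : continuous f ->
  exists2 C, 0 <= C & forall a, `|f a| <= C.
Proof.
move=> cf.
have scpt : compact (@simplex R n).
  apply: bounded_closed_compact.
    exists 1; split=> // C C1 v [v0 v1]; rewrite /= [leLHS]/Num.norm /= mx_normrE.
    apply/bigmax_leP; split=> [|[i j] _]; first exact: le_trans ler01 (ltW C1).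
    rewrite /= ord1 ger0_norm// (le_trans _ (ltW C1))// -v1 (bigD1 j)//= lerDl.
    by rewrite sumr_ge0.
  rewrite (_ : @simplex R n = (\bigcap_i [set v | 0 <= v 0 i]) `&`
      [set v | \sum_i v 0 i = 1]); last first.
    apply/seteqP; split=> v [v0 v1]; split => //= i; last exact: (v0 i I).
    by move=> _; exact: v0.
  apply: closedI.
    apply: closed_bigI => i _.
    apply: (@preimage_closed _ _ (fun v : 'rV[R]_n.+1 => v 0 i) [set x | 0 <= x]);
      last exact: closed_ge.
    by move=> v _; exact: coord_continuous.
  apply: (@preimage_closed _ _ (fun v : 'rV[R]_n.+1 => \sum_i v 0 i) [set x | x = 1]);
    last exact: closed_eq.
  move=> v _; apply: continuous_big => [|i _]; first exact: add_continuous.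
  exact: coord_continuous.
have := (@subspace_valL_continuousP' _ (@simplex R n) _ 0 f).2 cf.
move=> /continuous_compact /(_ scpt) /compact_bounded [C [_ fC]].
exists (`|C| + 1) => [|a]; first by rewrite addr_ge0.
apply: (fC (`|C| + 1)); first by rewrite (le_lt_trans (ler_norm _))// ltrDl.
exists (val a); first exact: set_mem (valP a).
exact: (congr1 (@^~ a) (valLK 0 f)).
Qed.

Lemma alpha_adjoint_exists (mu : probability Delta R) :
  exists nu : probability Delta R, forall f : Delta -> R, continuous f ->
    \int[nu]_a f a = \int[mu]_a alpha_op f a.
Proof.
have y0 : Y.
  case: (pickP Y) => // Y0; have := alpha_weight_sum1 point.
  by rewrite big_pred0// => /eqP; rewrite eq_sym oner_eq0.
exists (alpha_push y0 mu) => f cf.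
have mf := continuous_measurable_Delta cf.
have [C C0 fC] := continuous_bounded_Delta cf.
have mg : measurable_fun setT (fun a => f a + C) by exact: measurable_funD.
have g0 a : 0 <= f a + C by have := fC a; rewrite ler_norml => /andP[]; lra.
have opE a : alpha_op (fun a => f a + C) a = alpha_op f a + C.
  rewrite -[in RHS](alpha_op_cst C a) /alpha_op -big_split/=.
  by apply: eq_bigr => y _; rewrite mulrDr.
have ic (P : probability Delta R) (h : Delta -> R) : measurable_fun setT h ->
    (forall a, `|h a| <= C) -> P.-integrable setT (EFin \o h).
  move=> mh hC; apply: measurable_bounded_integrable => //.
    by rewrite [X in (X < _)%E]probability_setT ltry.
  exists C; split=> [|x Cx a _ /=]; first exact: num_real.
  exact: le_trans (hC a) (ltW Cx).
have opC a : `|alpha_op f a| <= C.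
  rewrite (le_trans (ler_norm_sum _ _ _))// -[leRHS](alpha_op_cst C a).
  apply: ler_sum => y _; rewrite normrM ger0_norm ?alpha_weight_ge0//.
  by rewrite ler_wpM2l ?alpha_weight_ge0.
have split (P : probability Delta R) (h : Delta -> R) : measurable_fun setT h ->
    (forall a, `|h a| <= C) -> \int[P]_a (h a + C) = \int[P]_a h a + C.
  move=> mh hC; rewrite RintegralD//; last 2 first.
  - exact: ic.
  - by apply: ic => // a; rewrite ger0_norm.
  by rewrite Rintegral_cst// [X in fine X]probability_setT mulr1.
apply: (addIr C); rewrite -split// -split//; last exact: measurable_alpha_op.
rewrite /Rintegral ge0_integral_alpha_push//; congr fine.
by apply: eq_integral => a _; rewrite opE.
Qed.

Lemma alpha_adjointP (mu : probability Delta R) (f : Delta -> R) : continuous f ->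
  \int[alpha_adjoint mu]_a f a = \int[mu]_a alpha_op f a.
Proof. by move: f; exact: (xgetPex mu (alpha_adjoint_exists mu)). Qed.

End adjoint_exists.
End AlphaChain.

(* Main.v *)
From HB Require Import structures.
Require Import Defs.
From mathcomp Require Import all_boot all_order all_algebra.
From mathcomp Require Import all_classical all_reals all_analysis.
From mathcomp Require Import measurable_realfun giry lra ring.

(** Write [T] for the operator of the alpha-chain.  Extended to the cone over the
    simplex by homogeneity, a function [f] becomes [F x = |x| f (x / |x|)], and
    [T] becomes [x |-> sum_y F (x M(y))]: the normalization disappears.  Since
    [sum_y |x M(y)|_1 <= |x|_1], a modulus of continuity measured on the cone is
    inherited by [T f] with the same constants.  So the iterates [T^k f] of a
    continuous [f] are equicontinuous ([alpha_op_cone_modulus]).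

    Let [A = u v] be the limit of rank one, with [v] in the simplex and
    [u_i0 > 0].  If [w] is a word with [c M(w)] close to [A], reading [w] brings
    every [alpha] whose coordinate [i0] is not small close to the single point
    [v], with a probability bounded below ([word_focus]).  By irreducibility, the
    coordinate [i0] has a mean bounded below over a window of [m] consecutive
    times, uniformly in the starting point.  Hence the mean of [T^j] over a window
    charges each neighbourhood of [v] with some mass [p > 0], whatever the
    starting point ([window_focusing]).  On an equicontinuous family the values
    near [v] are almost the value at [v], so each application of the window mean
    multiplies the oscillation by [1 - p], up to a small error
    ([window_cone_contract]), and its powers flatten [f] ([iter_window_flat]).
    The Cesaro means of [f] change little when [f] is replaced by a window mean
    of [f], so they converge uniformly to a constant ([cesaro_uniform_limit]).
    If [M] is aperiodic, windows of length one suffice; the window mean is then a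
    power of [T], and [T^k f] itself converges to a constant
    ([iter_uniform_limit]).

    The constant is a positive linear [T]-invariant functional of [f], hence the
    integral against a probability measure ([riesz_representation]), which is
    stationary.  If [nu] is stationary, the integral of [f] against [nu] equals
    that of its Cesaro means, hence the same constant; this gives uniqueness, and
    convergence from an arbitrary initial law follows in the same way by
    integrating a uniform limit ([unique_ergodicity]). *)

Set Implicit Arguments.
Unset Strict Implicit.
Unset Printing Implicit Defensive.

Import Order.TTheory GRing.Theory Num.Theory.
Import numFieldNormedType.Exports.

Local Open Scope classical_set_scope.
Local Open Scope ring_scope.

(** * The l1 distance on the simplex *)

Section Norm1.
Context {R : realType} {n : nat}.
Implicit Types x y : 'rV[R]_n.

Definition norm1 x : R := \sum_i `|x 0 i|.

Lemma norm1_ge0 x : 0 <= norm1 x.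
Proof. exact: sumr_ge0. Qed.

Lemma norm1_ge_coord x i : `|x 0 i| <= norm1 x.
Proof. by rewrite /norm1 (bigD1 i)//= lerDl sumr_ge0. Qed.

Lemma norm1D x y : norm1 (x + y) <= norm1 x + norm1 y.
Proof.
rewrite /norm1 -big_split/=; apply: ler_sum => i _.
by rewrite mxE; exact: ler_normD.
Qed.

Lemma norm1Z c x : norm1 (c *: x) = `|c| * norm1 x.
Proof. by rewrite /norm1 mulr_sumr; apply: eq_bigr => i _; rewrite mxE normrM. Qed.

Lemma norm1N x : norm1 (- x) = norm1 x.
Proof. by rewrite -scaleN1r norm1Z normrN1 mul1r. Qed.

Lemma norm1B x y : norm1 (x - y) = norm1 (y - x).
Proof. by rewrite -norm1N opprB. Qed.

Lemma norm1_triangle y x z : norm1 (x - z) <= norm1 (x - y) + norm1 (y - z).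
Proof. by rewrite (le_trans _ (norm1D _ _))// addrA subrK. Qed.

Lemma norm1_pos x : (forall i, 0 <= x 0 i) -> norm1 x = \sum_i x 0 i.
Proof. by move=> x0; apply: eq_bigr => i _; rewrite ger0_norm. Qed.

Lemma norm1_ge_sum x : `|\sum_i x 0 i| <= norm1 x.
Proof. exact: ler_norm_sum. Qed.

Lemma norm1_le_max x e : (forall i, `|x 0 i| <= e) -> norm1 x <= n%:R * e.
Proof.
move=> xe; rewrite /norm1 (le_trans (ler_sum _ (fun i _ => xe i)))//.
by rewrite sumr_const card_ord mulr_natl.
Qed.

End Norm1.

Section SimplexTopology.
Context {R : realType} {n : nat}.
Local Notation Delta := (Delta R n).
Implicit Types (f : Delta -> R) (a b : Delta).

Definition dist1 a b : R := norm1 (val a - val b).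

Lemma norm1_Delta a : norm1 (val a) = 1.
Proof. by rewrite norm1_pos ?Delta_sum1// => i; exact: Delta_ge0. Qed.

Lemma dist1C a b : dist1 a b = dist1 b a.
Proof. exact: norm1B. Qed.

Lemma dist1_triangle b a c : dist1 a c <= dist1 a b + dist1 b c.
Proof. exact: norm1_triangle. Qed.

Lemma dist1aa a : dist1 a a = 0.
Proof. by rewrite /dist1 subrr /norm1 big1// => i _; rewrite mxE normr0. Qed.

Lemma near_dist1 a e : 0 < e -> \forall b \near a, dist1 a b < e.
Proof.
move=> e0.
suff H : continuous (dist1 a).
  have := H a; rewrite /continuous_at dist1aa => /(_ [set x | x < e]); apply.
  by apply: open_nbhs_nbhs; split => //; exact: open_lt.
rewrite (_ : dist1 a = fun b => \sum_i `|val a 0 i - val b 0 i|); last first.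
  by apply/funext => b; apply: eq_bigr => i _; rewrite !mxE.
apply: continuous_big => [|i _ b]; first exact: add_continuous.
apply: (@cvg_norm _ _ _ (nbhs b)); apply: (@cvgB _ _ _ (nbhs b)).
  exact: cvg_cst.
exact: continuous_coord_Delta.
Qed.

Lemma nbhs_dist1 a (A : set Delta) : nbhs a A ->
  exists2 e : R, 0 < e & forall b, dist1 a b < e -> A b.
Proof.
rewrite -nbhs_ballE => -[e /= e0 eA]; exists e => // b ab; apply: eA.
rewrite /ball/=; split => // i j; rewrite ord1.
apply: le_lt_trans ab.
by have := norm1_ge_coord (val a - val b) j; rewrite !mxE.
Qed.

Lemma continuous_dist1P f :
  continuous f <-> forall a (e : R), 0 < e ->
    exists2 d : R, 0 < d & forall b, dist1 a b < d -> `|f a - f b| < e.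
Proof.
split=> [cf a e e0|H a].
  have /cvgrPdist_lt/(_ _ e0)/nbhs_dist1[d d0 dP] := cf a.
  by exists d.
apply: ((@cvgrPdist_lt _ _ _ (nbhs a) _ _ _).2 _) => e e0; have [d d0 dP] := H a e e0.
by apply: (@filterS _ (nbhs a) _ _ _ _ (near_dist1 a d0)) => b; exact: dP.
Qed.

Lemma compact_simplex : compact (@simplex R n).
Proof.
apply: bounded_closed_compact.
  exists 1; split=> // C C1 v [v0 v1]; rewrite /= [leLHS]/Num.norm /= mx_normrE.
  apply/bigmax_leP; split=> [|[i j] _]; first exact: le_trans ler01 (ltW C1).
  rewrite /= ord1 (le_trans (norm1_ge_coord v j))// norm1_pos// v1.
  exact: ltW.
rewrite (_ : @simplex R n = (\bigcap_i [set v | 0 <= v 0 i]) `&`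
    [set v | \sum_i v 0 i = 1]); last first.
  apply/seteqP; split=> v [v0 v1]; split => //= i; last exact: (v0 i I).
  by move=> _; exact: v0.
apply: closedI.
  apply: closed_bigI => i _.
  apply: (@preimage_closed _ _ (fun v : 'rV[R]_n.+1 => v 0 i) [set x | 0 <= x]);
    last exact: closed_ge.
  by move=> v _; exact: coord_continuous.
apply: (@preimage_closed _ _ (fun v : 'rV[R]_n.+1 => \sum_i v 0 i) [set x | x = 1]);
  last exact: closed_eq.
move=> v _; apply: continuous_big => [|i _]; first exact: add_continuous.
exact: coord_continuous.
Qed.

Lemma compact_Delta : compact [set: Delta].
Proof.
move=> F FF _.
have Fs : (val @ F) (@simplex R n).
  suff : F (val @^-1` @simplex R n) by [].
  by apply: filterS (@filterT _ F _) => a _; exact: set_mem (valP a).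
have [v [sv clv]] := @compact_simplex (val @ F) _ Fs.
exists (exist _ v (mem_set sv)); split => // A B FA [C [[W oW <-] WV WB]].
have [_ [[a Aa <-] Wa]] : (val @` A) `&` W !=set0.
  apply: clv; last by apply: open_nbhs_nbhs; split.
  suff : F (val @^-1` (val @` A)) by [].
  by apply: filterS FA => a Aa; exists a.
by exists a; split => //; exact: WB.
Qed.

Lemma uniformly_continuous_Delta f e : continuous f -> 0 < e ->
  exists2 d : R, 0 < d & forall a b, dist1 a b < d -> `|f a - f b| < e.
Proof.
move=> cf e0.
have /compact_near_coveringP/(_ _ (0:R)^'+
    (fun d a => forall b, dist1 a b < d -> `|f a - f b| < e)) := compact_Delta.
case=> [a _|d /= d0 dP].
  have [d d0 dP] := (continuous_dist1P f).1 cf a (e / 2) (divr_gt0 e0 (ltr0n _ 2)).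
  have d20 : 0 < d / 2 by exact: divr_gt0.
  exists ([set b | dist1 a b < d / 2], [set x | x < d / 2]) => /=.
    by split; [exact: near_dist1|exact: nbhs_right_lt].
  move=> [b x]/= [ab xd] c bc.
  rewrite (le_lt_trans (ler_distD (f a) _ _))// distrC (splitr e) ltrD//.
    by rewrite dP// (lt_le_trans ab)// ler_pdivrMr// ler_peMr ?ltW// ltr1n.
  rewrite dP// (le_lt_trans (dist1_triangle b _ _))// (splitr d) ltrD//.
  exact: lt_trans xd.
exists (d / 2) => [|a b ab]; first exact: divr_gt0.
apply: (dP (d / 2)) => //=; last exact: divr_gt0.
by rewrite sub0r normrN gtr0_norm ?divr_gt0// ltr_pdivrMr// ltr_pMr// ltr1n.
Qed.

End SimplexTopology.

(** * Continuous functions on the simplex *)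

Section ContinuousFunctions.
Context {R : realType} {n : nat}.
Local Notation Delta := (Delta R n).
Implicit Types (f g : Delta -> R) (a b : Delta).

Lemma continuous_cst_Delta (c : R) : continuous (fun _ : Delta => c).
Proof. by move=> a; apply: (@cvg_cst _ _ _ (nbhs a)). Qed.

Lemma continuousD_Delta f g : continuous f -> continuous g ->
  continuous (fun a => f a + g a).
Proof. by move=> cf cg a; apply: (@cvgD _ _ _ (nbhs a)); [exact: cf|exact: cg]. Qed.

Lemma continuousM_Delta f g : continuous f -> continuous g ->
  continuous (fun a => f a * g a).
Proof. by move=> cf cg a; apply: (@cvgM _ _ (nbhs a)); [exact: cf|exact: cg]. Qed.

Lemma continuousZ_Delta c f : continuous f -> continuous (fun a => c * f a).
Proof. by move=> cf; apply: continuousM_Delta => //; exact: continuous_cst_Delta. Qed.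

Lemma continuousB_Delta f g : continuous f -> continuous g ->
  continuous (fun a => f a - g a).
Proof. by move=> cf cg a; apply: (@cvgB _ _ _ (nbhs a)); [exact: cf|exact: cg]. Qed.

Lemma continuous_min_Delta c f : continuous f -> continuous (fun a => Num.min c (f a)).
Proof.
move=> /continuous_dist1P cf; apply/continuous_dist1P => a e e0.
have [d d0 dP] := cf a e e0; exists d => // b /dP.
apply: le_lt_trans; rewrite ler_norml.
have := ler_norm (f b - f a); have := ler_norm (f a - f b); rewrite (distrC (f b)).
by rewrite /Num.min; case: (ltP c (f a)); case: (ltP c (f b)); lra.
Qed.

Lemma continuous_sum_Delta (I : Type) (r : seq I) (F : I -> Delta -> R) :
  (forall i, continuous (F i)) -> continuous (fun a => \sum_(i <- r) F i a).
Proof.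
move=> cF; elim: r => [|i r IH].
  rewrite (_ : (fun a => _) = fun=> 0); first exact: continuous_cst_Delta.
  by apply/funext => a; rewrite big_nil.
rewrite (_ : (fun a => _) = fun a => F i a + \sum_(j <- r) F j a).
  exact: continuousD_Delta.
by apply/funext => a; rewrite big_cons.
Qed.

(** The distance to the complement of [U], capped at [1] so that it is defined when
    the complement is empty. *)
Lemma open_positivity_set (U : set Delta) : open U ->
  exists u : Delta -> R, [/\ continuous u, forall a, 0 <= u a &
    forall a, U a <-> 0 < u a].
Proof.
move=> oU.
pose D a := [set x : R | x = 1 \/ exists2 b, ~ U b & x = dist1 a b].
have D0 a x : D a x -> 0 <= x by move=> [->|[b _ ->]]//; exact: norm1_ge0.
have infD a : has_inf (D a).
  by split; [exists 1; left|exists 0 => x; exact: D0].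
pose u a := inf (D a).
have lip a b : u a <= u b + dist1 a b.
  rewrite -lerBlDr; apply: lb_le_inf; first by exists 1; left.
  move=> _ [->|[c Uc ->]]; rewrite lerBlDr.
    rewrite (@le_trans _ _ 1) ?lerDl ?norm1_ge0//.
    by apply: ge_inf; [case: (infD a)|left].
  rewrite (@le_trans _ _ (dist1 a c))//.
    by apply: ge_inf; [case: (infD a)|right; exists c].
  by rewrite addrC dist1_triangle.
exists u; split=> [|a|a].
- apply/continuous_dist1P => a e e0; exists e => // b; apply: le_lt_trans.
  have := lip a b; have := lip b a; rewrite (dist1C b a) ler_norml; lra.
- by apply: lb_le_inf => [|x]; [exists 1; left|exact: D0].
split=> [Ua|ua].
  have [e e0 eU] := nbhs_dist1 (open_nbhs_nbhs (conj oU Ua)).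
  rewrite (@lt_le_trans _ _ (Num.min 1 e))// ?lt_min ?ltr01//.
  apply: lb_le_inf => [|_ [->|[b Ub ->]]]; first by exists 1; left.
    by rewrite ge_min lexx.
  by rewrite ge_min; apply/orP; right; rewrite leNgt; apply/negP => /eU.
apply: contrapT => Ua; move: ua; rewrite ltNge => /negP; apply.
by apply: ge_inf; [case: (infD a)|right; exists a => //; rewrite dist1aa].
Qed.

Lemma open_indicator_approx (U : set Delta) : open U ->
  exists phi : nat -> Delta -> R,
    [/\ forall k, continuous (phi k), forall k a, 0 <= phi k a <= 1,
        forall a, {homo phi^~ a : k l / (k <= l)%N >-> k <= l},
        forall k a, ~ U a -> phi k a = 0 &
        forall a, U a -> exists k0, forall k, (k0 <= k)%N -> phi k a = 1].
Proof.
move=> oU; have [u [cu u0 uU]] := open_positivity_set oU.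
exists (fun k a => Num.min 1 (k%:R * u a)); split.
- by move=> k; apply: continuous_min_Delta; exact: continuousZ_Delta.
- by move=> k a; rewrite le_min ler01 mulr_ge0// ge_min lexx.
- by move=> a k l kl; rewrite le_min2// ler_wpM2r// ler_nat.
- move=> k a Ua; rewrite (_ : u a = 0) ?mulr0 ?(min_idPr _)//.
  by apply/eqP; rewrite eq_le u0 andbT leNgt; apply/negP => /uU.
move=> a /uU ua; exists (Num.truncn (u a)^-1).+1 => k kl.
apply/min_idPl; rewrite -ler_pdivrMr// mul1r.
by rewrite (le_trans (ltW (truncnS_gt _)))// ler_nat.
Qed.

End ContinuousFunctions.

(** * Moduli of continuity on the cone *)

Section ConeModulus.
Context {R : realType} {n : nat}.
Local Notation Delta := (Delta R n).
Implicit Types (f : Delta -> R) (a b : Delta).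

(** The modulus of continuity of the homogeneous extension [s a |-> s f a] of [f] to
    the cone; [eps] is charged per unit of mass.  It is stated on the cone because
    [alpha_op] acts there through the linear maps [x |-> x M(y)]. *)
Definition cone_modulus (eps C : R) f := forall a b s t, 0 <= s -> 0 <= t ->
  `|s * f a - t * f b| <= eps * s + C * norm1 (s *: val a - t *: val b).

Lemma cone_modulus_dist1 eps C f a b : cone_modulus eps C f ->
  `|f a - f b| <= eps + C * dist1 a b.
Proof. by move=> /(_ a b 1 1 ler01 ler01); rewrite !mul1r !scale1r mulr1. Qed.

Lemma norm1_mass a b s t : `|s - t| <= norm1 (s *: val a - t *: val b).
Proof.
rewrite (_ : s - t = \sum_i (s *: val a - t *: val b) 0 i) ?norm1_ge_sum//.
rewrite (eq_bigr (fun i => s * val a 0 i - t * val b 0 i)); last first.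
  by move=> i _; rewrite !mxE.
by rewrite sumrB -!mulr_sumr !Delta_sum1 !mulr1.
Qed.

(** Points closer than the distance given by uniform continuity are covered by [eps],
    the others by a Lipschitz term, as [f] is bounded.  A change of mass costs at
    most a bound of [f] times the difference of the masses. *)
Lemma continuous_cone_modulus f (eps : R) : continuous f -> 0 < eps ->
  exists2 C : R, 0 <= C & cone_modulus eps C f.
Proof.
move=> cf eps0.
have [B B0 fB] : exists2 B : R, 0 <= B & forall a, `|f a| <= B :=
  continuous_bounded_Delta cf.
have [d d0 fd] := uniformly_continuous_Delta cf eps0.
pose C0 : R := 2 * B / d.
have C00 : 0 <= C0 by rewrite divr_ge0 ?mulr_ge0 ?(ltW d0).
have lip a b : `|f a - f b| <= eps + C0 * dist1 a b.
  have [ab|ab] := ltP (dist1 a b) d.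
    by rewrite (le_trans (ltW (fd _ _ ab)))// lerDl mulr_ge0 ?norm1_ge0.
  rewrite (@le_trans _ _ (B + B))//.
    by rewrite (le_trans (ler_normB _ _))// lerD.
  rewrite (@le_trans _ _ (C0 * d))//.
    by rewrite /C0 divfK ?gt_eqF// mulr2n mulrDl mul1r.
  apply: le_trans (ler_wpM2l C00 ab) _; rewrite lerDr ltW//.
have C10 : 0 <= B + 2 * C0 by rewrite addr_ge0// mulr_ge0.
exists (B + 2 * C0) => // a b s t s0 t0.
set N := norm1 _.
have st : `|s - t| <= N := norm1_mass a b s t.
have sab : s * dist1 a b <= 2 * N.
  rewrite -[s in s * _]ger0_norm// -norm1Z.
  rewrite (_ : s *: (val a - val b) =
    (s *: val a - t *: val b) + (t - s) *: val b); last first.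
    by rewrite scalerBr scalerBl addrA subrK.
  rewrite (le_trans (norm1D _ _))// norm1Z norm1_Delta mulr1 -/N distrC; lra.
have -> : s * f a - t * f b = s * (f a - f b) + (s - t) * f b by ring.
rewrite (le_trans (ler_normD _ _))// !normrM (ger0_norm s0).
have h1 : s * `|f a - f b| <= s * eps + C0 * (2 * N).
  rewrite (le_trans (ler_wpM2l s0 (lip a b)))// mulrDr lerD2l mulrCA.
  exact: ler_wpM2l.
have h2 : `|s - t| * `|f b| <= N * B by rewrite ler_pM.
rewrite (le_trans (lerD h1 h2))// le_eqVlt; apply/orP; left; apply/eqP; ring.
Qed.

Lemma cone_modulus_continuous f :
  (forall eps, 0 < eps -> exists2 C : R, 0 <= C & cone_modulus eps C f) ->
  continuous f.
Proof.
move=> H; apply/continuous_dist1P => a e e0.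
have [C C0 fC] := H (e / 2) (divr_gt0 e0 (ltr0n _ 2)).
have C1 : 0 < C + 1 by rewrite ltr_wpDl.
exists (e / 2 / (C + 1)) => [|b ab]; first by rewrite !divr_gt0.
rewrite (le_lt_trans (cone_modulus_dist1 _ _ fC))// [ltRHS]splitr ltrD2l.
rewrite (@le_lt_trans _ _ ((C + 1) * dist1 a b))//.
  by rewrite ler_wpM2r ?norm1_ge0// lerDl.
by rewrite mulrC -ltr_pdivlMr.
Qed.

End ConeModulus.

(** * The operator of the alpha-chain and equicontinuity *)

Section AlphaOperator.
Context {R : realType} {n : nat} {Y : finType} (Mf : Y -> 'M[R]_n.+1).
Hypothesis Mf_ge0 : forall y, nonneg_mx (Mf y).
Hypothesis Mf_markov : markov_mx (\sum_y Mf y).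
Local Notation Delta := (Delta R n).
Local Notation T := (alpha_op Mf).
Implicit Types (f g : Delta -> R) (a b : Delta).

(** Holds for weight [0] as well, whatever the value of [alpha_next] is then: the entries of
    [val a *m Mf y] are nonnegative with sum [0]. *)
Lemma alpha_weight_next y a :
  alpha_weight Mf y a *: val (alpha_next Mf y a) = val a *m Mf y.
Proof.
have [w0|w0] := eqVneq (alpha_weight Mf y a) 0; last first.
  by rewrite (val_alpha_next Mf_ge0 w0) scalerA mulfV// scale1r.
rewrite w0 scale0r; apply/rowP => j; rewrite mxE; apply/esym.
have /psumr_eq0P H : forall j, true -> 0 <= (val a *m Mf y) 0 j.
  by move=> i _; exact: alpha_step_ge0.
by apply: H => //; rewrite -alpha_weightE.
Qed.

Lemma norm1_sum_mul (x : 'rV[R]_n.+1) : \sum_y norm1 (x *m Mf y) <= norm1 x.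
Proof.
rewrite [leRHS](_ : _ = \sum_y \sum_j \sum_i `|x 0 i| * Mf y i j).
  apply: ler_sum => y _; apply: ler_sum => j _.
  rewrite mxE (le_trans (ler_norm_sum _ _ _))//; apply: ler_sum => i _.
  by rewrite normrM (ger0_norm (Mf_ge0 y i j)).
rewrite exchange_big/=.
under eq_bigr do rewrite exchange_big/=.
rewrite exchange_big/=; apply: eq_bigr => i _.
under eq_bigr do rewrite -mulr_sumr -summxE.
by rewrite -mulr_sumr (proj2 Mf_markov) mulr1.
Qed.

(** The point [s a] of the cone has the children [s a M(y)].  Their masses add up to
    [s], and the distances between the children of two points add up to at most
    the distance of the points, so both error terms are reproduced exactly. *)
Lemma alpha_op_cone_modulus eps C f : 0 <= C ->
  cone_modulus eps C f -> cone_modulus eps C (T f).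
Proof.
move=> C0 fC a b s t s0 t0; rewrite /alpha_op !mulr_sumr -sumrB.
rewrite (le_trans (ler_norm_sum _ _ _))//.
rewrite (@le_trans _ _ (\sum_y (eps * (s * alpha_weight Mf y a) +
   C * norm1 ((s *: val a - t *: val b) *m Mf y))))//.
  apply: ler_sum => y _; rewrite !mulrA.
  apply: le_trans (fC _ _ _ _ _ _) _; rewrite ?mulr_ge0 ?alpha_weight_ge0//.
  by rewrite -!scalerA !alpha_weight_next mulmxBl -!scalemxAl -!mulrA.
rewrite big_split/= -!mulr_sumr alpha_weight_sum1// mulr1 lerD2l.
by rewrite ler_wpM2l// norm1_sum_mul.
Qed.

Lemma iter_cone_modulus eps C f k : 0 <= C ->
  cone_modulus eps C f -> cone_modulus eps C (iter k T f).
Proof. by move=> C0 fC; elim: k => //= k IH; exact: alpha_op_cone_modulus. Qed.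

Lemma continuous_alpha_op f : continuous f -> continuous (T f).
Proof.
move=> cf; apply: cone_modulus_continuous => e e0.
have [C C0 fC] := continuous_cone_modulus cf e0.
by exists C => //; exact: alpha_op_cone_modulus.
Qed.

Lemma continuous_iter_alpha_op f k : continuous f -> continuous (iter k T f).
Proof. by move=> cf; elim: k => //= k; exact: continuous_alpha_op. Qed.

Lemma alpha_opD f g : T (fun a => f a + g a) = fun a => T f a + T g a.
Proof.
apply/funext => a; rewrite /alpha_op -big_split/=.
by apply: eq_bigr => y _; rewrite mulrDr.
Qed.

Lemma alpha_opZ c f : T (fun a => c * f a) = fun a => c * T f a.
Proof.
apply/funext => a; rewrite /alpha_op mulr_sumr.
by apply: eq_bigr => y _; rewrite mulrCA.
Qed.

Lemma ler_alpha_op f g : (forall a, f a <= g a) -> forall a, T f a <= T g a.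
Proof.
move=> fg a; apply: ler_sum => y _; rewrite ler_wpM2l//.
exact: alpha_weight_ge0.
Qed.

Lemma iter_alpha_opD k f g :
  iter k T (fun a => f a + g a) = fun a => iter k T f a + iter k T g a.
Proof. by elim: k => //= k ->; exact: alpha_opD. Qed.

Lemma iter_alpha_opZ k c f :
  iter k T (fun a => c * f a) = fun a => c * iter k T f a.
Proof. by elim: k => //= k ->; exact: alpha_opZ. Qed.

Lemma iter_alpha_op_cst k c : iter k T (fun=> c) = fun=> c.
Proof. by elim: k => //= k ->; apply/funext => a; rewrite alpha_op_cst. Qed.

Lemma ler_iter_alpha_op k f g : (forall a, f a <= g a) ->
  forall a, iter k T f a <= iter k T g a.
Proof. by move=> fg; elim: k => //= k IH; exact: ler_alpha_op. Qed.

End AlphaOperator.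

(** * Words close to a matrix of rank one *)

Section RankOne.
Context {R : realType} {n : nat}.

(** All rows are multiples of one nonzero row; normalized, it is the point [v], and
    the coefficient of a row is its sum. *)
Lemma rank1_nonneg_factor (A : 'M[R]_n.+1) : nonneg_mx A -> \rank A = 1%N ->
  exists (v : Delta R n) i0, 0 < \sum_j A i0 j /\
    forall i j, A i j = (\sum_k A i k) * val v 0 j.
Proof.
move=> A0 rA.
have [i0 ri0] : exists i0, row i0 A != 0.
  apply/existsP; apply: contra_eqT rA => /existsPn H.
  rewrite (_ : A = 0) ?mxrank0//; apply/row_matrixP => i.
  by rewrite row0; apply/eqP; have := H i; rewrite negbK.
have u0 : 0 < \sum_j A i0 j.
  rewrite lt_neqAle sumr_ge0 ?andbT//; apply: contra_neq ri0 => /esym s0.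
  apply/rowP => j; rewrite !mxE.
  have /psumr_eq0P H : forall j, true -> 0 <= A i0 j by move=> k _; exact: A0.
  exact: H.
pose v0 : 'rV[R]_n.+1 := (\sum_j A i0 j)^-1 *: row i0 A.
have sv0 : simplex v0.
  split=> [j|]; first by rewrite !mxE mulr_ge0// invr_ge0 ltW.
  under eq_bigr do rewrite !mxE.
  by rewrite -mulr_sumr mulVf// gt_eqF.
exists (exist _ v0 (mem_set sv0)), i0; split=> // i j /=.
have : (row i A <= row i0 A)%MS.
  apply: submx_trans (row_sub i A) _.
  suff: (row i0 A == A)%MS by case/andP.
  have [_ <-] := mxrank_leqif_eq (row_sub i0 A).
  by rewrite rA rank_rV ri0.
case/sub_rVP => c rc.
have Ac k : A i k = c * A i0 k by have /rowP/(_ k) := rc; rewrite !mxE.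
rewrite !mxE Ac (eq_bigr (fun k => c * A i0 k)) // -mulr_sumr.
by rewrite mulrA mulfK ?gt_eqF.
Qed.

Lemma closure_entrywise (S : set 'M[R]_n.+1) A e : closure S A -> 0 < e ->
  exists2 B, S B & forall i j, `|A i j - B i j| < e.
Proof.
move=> cA e0; have [|B [SB [_ AB]]] := cA (ball A e); first exact: nbhsx_ballx.
by exists B.
Qed.

End RankOne.

Section WordReach.
Context {R : realType} {n : nat} {Y : finType} (Mf : Y -> 'M[R]_n.+1).
Hypothesis Mf_ge0 : forall y, nonneg_mx (Mf y).
Local Notation Delta := (Delta R n).
Local Notation T := (alpha_op Mf).
Implicit Types (f g : Delta -> R) (a b : Delta).

Lemma iter_alpha_op_ge0 k g : (forall a, 0 <= g a) -> forall a, 0 <= iter k T g a.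
Proof.
move=> g0; elim: k => //= k IH a; rewrite /alpha_op sumr_ge0// => y _.
by rewrite mulr_ge0// alpha_weight_ge0.
Qed.

Lemma word_nonneg (w : seq Y) : nonneg_mx (\prod_(y <- w) Mf y).
Proof.
elim: w => [|y w IH] i j; first by rewrite big_nil mxE ler0n.
by rewrite big_cons mxE sumr_ge0// => k _; rewrite mulr_ge0//; exact: Mf_ge0.
Qed.

(** From [a] the chain reads the word [w] with probability [p] and is then at [b]; the
    other paths contribute nonnegative terms.  For [p = 0] the point [b] is
    arbitrary. *)
Lemma word_reach (w : seq Y) a : exists b (p : R),
  [/\ 0 <= p, val a *m (\prod_(y <- w) Mf y) = p *: val b &
      forall g, (forall b, 0 <= g b) -> p * g b <= iter (size w) T g a].
Proof.
elim: w a => [|y w IH] a.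
  exists a, 1; rewrite big_nil scale1r mulmx1; split=> // g g0.
  by rewrite mul1r.
have [b [p [p0 bE bP]]] := IH (alpha_next Mf y a).
have w0 := alpha_weight_ge0 Mf_ge0 y a.
exists b, (alpha_weight Mf y a * p); split; first exact: mulr_ge0.
  by rewrite big_cons mulmxA -alpha_weight_next// -scalemxAl bE scalerA.
move=> g g0; rewrite [leRHS](_ : _ = \sum_z alpha_weight Mf z a *
  iter (size w) T g (alpha_next Mf z a))// (bigD1 y)//= -mulrA.
rewrite (le_trans (ler_wpM2l w0 (bP g g0)))// lerDl sumr_ge0// => z _.
by rewrite mulr_ge0 ?alpha_weight_ge0// iter_alpha_op_ge0.
Qed.

(** For a word [w] with [c M(w)] close to [A], the vector [c a M(w)] is close to
    [a A = au v], where [au] is bounded below if the coordinate [i0] of [a] is.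
    So its direction is close to [v], and its mass is bounded below. *)
Lemma word_focus (v : Delta) i0 (A : 'M[R]_n.+1) (eta delta : R) :
    closure (mx_cone Mf) A -> (forall i j, A i j = (\sum_k A i k) * val v 0 j) ->
    (forall i, 0 <= \sum_k A i k) -> 0 < \sum_k A i0 k ->
    0 < eta -> 0 < delta ->
  exists (l : nat) (p : R), 0 < p /\ forall a, delta <= val a 0 i0 ->
    exists2 b, dist1 v b <= eta &
      forall g, (forall b, 0 <= g b) -> p * g b <= iter l T g a.
Proof.
move=> clA AE u0 ui0 eta0 delta0.
pose u i := \sum_k A i k.
pose U := delta * u i0; pose kap := U * Num.min eta 1 / 2.
have U0 : 0 < U by exact: mulr_gt0.
have m0 : 0 < Num.min eta 1 by rewrite lt_min eta0 ltr01.
have kap0 : 0 < kap by rewrite divr_gt0// mulr_gt0.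
(* An entrywise error [kap / n.+1] is an l1 error of at most [kap], which moves
   the direction of a vector of mass [U] by at most [2 kap / U <= eta]. *)
have z0 : 0 < kap / n.+1%:R by rewrite divr_gt0.
have [B [c /= c0 [_ [w _ <-] <-]]] := closure_entrywise clA z0.
set W := \prod_(y <- w) Mf y => AB.
exists (size w), (U / 2 / c); split; first by rewrite !divr_gt0.
move=> a ai0.
have [b [p [p0 bE bP]]] := word_reach w a; rewrite -/W in bE.
pose au := \sum_i val a 0 i * u i.
have auU : U <= au.
  rewrite /au (bigD1 i0)//= /U ler_wpDr ?ler_wpM2r ?u0// sumr_ge0// => i _.
  by rewrite mulr_ge0 ?Delta_ge0 ?u0.
have aA : val a *m A = au *: val v.
  apply/rowP => j; rewrite !mxE /au mulr_suml; apply: eq_bigr => i _.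
  by rewrite [in LHS]AE mulrA.
have dist : norm1 (au *: val v - (c * p) *: val b) <= kap.
  rewrite -aA -scalerA -bE scalemxAr -mulmxBr.
  rewrite (@le_trans _ _ (n.+1%:R * (kap / n.+1%:R)))//; last first.
    by rewrite mulrC divfK// pnatr_eq0.
  apply: norm1_le_max => j; rewrite mxE.
  have -> : kap / n.+1%:R = \sum_i val a 0 i * (kap / n.+1%:R).
    by rewrite -mulr_suml Delta_sum1 mul1r.
  rewrite (le_trans (ler_norm_sum _ _ _))//; apply: ler_sum => i _.
  rewrite normrM ger0_norm ?Delta_ge0// ler_wpM2l ?Delta_ge0//.
  by have /ltW := AB i j; rewrite !mxE.
have mass : `|au - c * p| <= kap := le_trans (norm1_mass v b au (c * p)) dist.
exists b.
  have au0 : 0 < au by exact: lt_le_trans auU.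
  rewrite -(ler_pM2l au0) -[au in leLHS]gtr0_norm// -norm1Z.
  rewrite (_ : au *: (val v - val b) =
    (au *: val v - (c * p) *: val b) + (c * p - au) *: val b); last first.
    by rewrite scalerBr scalerBl addrA subrK.
  rewrite (le_trans (norm1D _ _))// norm1Z norm1_Delta mulr1 distrC.
  rewrite (le_trans (lerD dist mass))// -mulr2n -mulr_natr /kap divfK ?pnatr_eq0//.
  by rewrite ler_pM ?(ltW U0) ?(ltW m0)// ge_min lexx.
move=> g g0; apply: le_trans (bP g g0); rewrite ler_wpM2r//.
rewrite ler_pdivrMr// mulrC.
have kU : kap <= U / 2.
  rewrite /kap ler_pM2r ?invr_gt0// -[leRHS]mulr1 ler_pM2l//.
  by rewrite ge_min lexx orbT.
move: mass; rewrite ler_norml => /andP[_]; lra.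
Qed.

End WordReach.

(** * Means over a window of times *)

Section Window.
Context {R : realType} {n : nat} {Y : finType} (Mf : Y -> 'M[R]_n.+1).
Hypothesis Mf_ge0 : forall y, nonneg_mx (Mf y).
Hypothesis Mf_markov : markov_mx (\sum_y Mf y).
Local Notation Delta := (Delta R n).
Local Notation T := (alpha_op Mf).
Local Notation M := (\sum_y Mf y).
Implicit Types (f g h : Delta -> R) (a b v : Delta).

(** The mean over several consecutive times removes the dependence on the period of
    the matrix. *)
Definition window m q f a : R := m%:R^-1 * \sum_(j < m) iter (q + j) T f a.

(** On indicators: from any point, [Q] moves to the [eta]-neighbourhood of [v] with
    probability at least [p]. *)
Definition minorized (Q : (Delta -> R) -> Delta -> R) v (eta p : R) :=
  forall g c, (forall a, 0 <= g a) -> 0 <= c ->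
    (forall b, dist1 v b <= eta -> c <= g b) -> forall a, p * c <= Q g a.

Definition focusing m q v := forall eta : R, 0 < eta ->
  exists (l : nat) (p : R), 0 < p <= 1 /\ minorized (window m (q + l)) v eta p.

(** The coordinates span the linear functions on the simplex, and [alpha_op] acts on
    them through the matrix alone. *)
Lemma iter_alpha_op_coord k i a :
  iter k T (fun b => val b 0 i) a = (val a *m M ^+ k) 0 i.
Proof.
elim: k a => [|k IH] a; first by rewrite expr0 mulmx1.
rewrite /= /alpha_op exprS mulmxA mulmx_sumr mulmx_suml summxE.
apply: eq_bigr => y _; rewrite IH -(alpha_weight_next Mf_ge0) -scalemxAl.
by rewrite [RHS]mxE.
Qed.

Section window_laws.
Variables m q : nat.
Hypothesis m_gt0 : (0 < m)%N.

Let m0 : 0 <= m%:R^-1 :> R. Proof. by rewrite invr_ge0. Qed.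

Let m1 : m%:R != 0 :> R. Proof. by rewrite pnatr_eq0 -lt0n. Qed.

Lemma ler_window f g : (forall a, f a <= g a) ->
  forall a, window m q f a <= window m q g a.
Proof.
move=> fg a; rewrite ler_wpM2l//; apply: ler_sum => j _.
exact: ler_iter_alpha_op.
Qed.

Lemma window_cst c a : window m q (fun=> c) a = c.
Proof.
rewrite /window (eq_bigr (fun=> c)) => [|j _]; last first.
  by rewrite iter_alpha_op_cst.
by rewrite sumr_const card_ord -[c *+ m]mulr_natl mulrA mulVf// mul1r.
Qed.

Lemma windowD f g a : window m q (fun b => f b + g b) a = window m q f a + window m q g a.
Proof.
rewrite /window -mulrDr -big_split/=; congr (_ * _); apply: eq_bigr => j _.
by rewrite iter_alpha_opD.
Qed.

Lemma windowZ c f a : window m q (fun b => c * f b) a = c * window m q f a.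
Proof.
rewrite /window mulrCA [in RHS]mulr_sumr; congr (_ * _); apply: eq_bigr => j _.
by rewrite iter_alpha_opZ.
Qed.

Lemma window_cone_modulus eps C f : 0 <= C ->
  cone_modulus eps C f -> cone_modulus eps C (window m q f).
Proof.
move=> C0 fC a b s t s0 t0.
rewrite /window !(mulrCA _ m%:R^-1) -mulrBr [s * _]mulr_sumr [t * _]mulr_sumr -sumrB.
rewrite normrM ger0_norm// ler_pdivrMl; last by rewrite ltr0n.
rewrite (le_trans (ler_norm_sum _ _ _))// mulr_natl.
rewrite -[X in _ *+ X]card_ord -sumr_const; apply: ler_sum => j _.
exact: (iter_cone_modulus Mf_ge0 Mf_markov (q + j) C0 fC).
Qed.

(** Near [v] both [h - lo] and [hi - h] are, up to [eps + C eta], at least their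
    values at [v], and these two values add up to [hi - lo].  The minorization of
    both raises [lo] and lowers [hi] by a total of [p (hi - lo)], up to the
    error. *)
Lemma window_cone_contract (p eta eps C lo hi : R) v h :
    0 <= C -> cone_modulus eps C h -> (forall a, lo <= h a <= hi) ->
    minorized (window m q) v eta p -> 0 <= p ->
  exists lo' hi', hi' - lo' <= (1 - p) * (hi - lo) + 2 * p * (eps + C * eta) /\
    forall a, lo' <= window m q h a <= hi'.
Proof.
move=> C0 hC lohi minor p0.
have close b : dist1 v b <= eta -> `|h v - h b| <= eps + C * eta.
  move=> vb; rewrite (le_trans (cone_modulus_dist1 v b hC))//.
  by rewrite lerD2l ler_wpM2l.
pose z := eps + C * eta.
exists (lo + p * (h v - lo - z)), (hi - p * (hi - h v - z)); split.
  by rewrite -/z le_eqVlt; apply/orP; left; apply/eqP; ring.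
move=> a; apply/andP; split.
  have := minor (fun b => h b + - lo) (Num.max 0 (h v - lo - z)).
  move/(_ _ _ _ a); rewrite windowD window_cst => H.
  have {}H : p * Num.max 0 (h v - lo - z) <= window m q h a - lo.
    apply: H => [b||b vb]; first by have /andP[] := lohi b; lra.
      by rewrite le_max lexx.
    rewrite ge_max; apply/andP; split; first by have /andP[] := lohi b; lra.
    by have := close _ vb; rewrite -/z ler_norml => /andP[]; lra.
  have : p * (h v - lo - z) <= p * Num.max 0 (h v - lo - z).
    by rewrite ler_wpM2l// le_max lexx orbT.
  by move: (p * Num.max _ _) H => x; lra.
have := minor (fun b => (-1) * h b + hi) (Num.max 0 (hi - h v - z)).
move/(_ _ _ _ a); rewrite windowD windowZ window_cst mulN1r => H.
have {}H : p * Num.max 0 (hi - h v - z) <= - window m q h a + hi.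
  apply: H => [b||b vb]; first by have /andP[] := lohi b; lra.
    by rewrite le_max lexx.
  rewrite ge_max; apply/andP; split; first by have /andP[] := lohi b; lra.
  by have := close _ vb; rewrite -/z ler_norml => /andP[]; lra.
have : p * (hi - h v - z) <= p * Num.max 0 (hi - h v - z).
  by rewrite ler_wpM2l// le_max lexx orbT.
by move: (p * Num.max _ _) H => x; lra.
Qed.

End window_laws.

(** A nonnegative function that is at least [p c] where the coordinate [i0] is at least
    [delta / 2] lies above [p c (b_i0 - delta / 2)].  That function is affine in
    [b], so its window mean is read off the powers of the matrix. *)
Lemma window_focusing m q (delta : R) v i0 (A : 'M[R]_n.+1) :
    (0 < m)%N -> 0 < delta ->
    (forall a, delta * m%:R <= \sum_(j < m) (val a *m M ^+ (q + j)) 0 i0) ->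
    closure (mx_cone Mf) A -> (forall i j, A i j = (\sum_k A i k) * val v 0 j) ->
    (forall i, 0 <= \sum_k A i k) -> 0 < \sum_k A i0 k ->
  focusing m q v.
Proof.
move=> m0 delta0 reach clA AE u0 ui0 eta eta0.
have d20 : 0 < delta / 2 by exact: divr_gt0.
have [l [p [p0 focus]]] := word_focus Mf_ge0 clA AE u0 ui0 eta0 d20.
exists l, (p * (delta / 2)).
have minor : minorized (window m (q + l)) v eta (p * (delta / 2)).
  move=> g c g0 c0 gc a.
  have h0 := iter_alpha_op_ge0 Mf_ge0 l g0.
  have hlb b : p * c * (val b 0 i0 + - (delta / 2)) <= iter l T g b.
    have [bi|bi] := leP (delta / 2) (val b 0 i0).
      have [b' vb' bP] := focus b bi.
      rewrite (le_trans _ (bP g g0))// -mulrA ler_wpM2l ?(ltW p0)//.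
      apply: le_trans (gc _ vb'); rewrite ler_piMr//.
      have : val b 0 i0 <= 1.
        rewrite -[leRHS](norm1_Delta b) (le_trans _ (norm1_ge_coord _ i0))//.
        exact: ler_norm.
      lra.
    rewrite (le_trans _ (h0 b))// mulr_ge0_le0 ?mulr_ge0 ?(ltW p0)//.
    lra.
  have -> : window m (q + l) g a = window m q (iter l T g) a.
    rewrite /window; congr (_ * _); apply: eq_bigr => j _.
    by rewrite -iterD addnAC.
  apply: le_trans (ler_window m q hlb a).
  rewrite windowZ windowD window_cst//.
  have : delta <= window m q (fun b => val b 0 i0) a.
    rewrite /window ler_pdivlMl ?ltr0n// mulrC (le_trans (reach a))//.
    by apply: ler_sum => j _; rewrite iter_alpha_op_coord.
  set x := window _ _ _ _ => dx.
  have pc0 : 0 <= p * c by rewrite mulr_ge0// ltW.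
  rewrite -mulrA (mulrC _ c) mulrA ler_wpM2l//; lra.
split=> //; rewrite mulr_gt0//=.
have := minor (fun=> 1) 1 (fun=> ler01) ler01 (fun _ _ => lexx 1) point.
by rewrite mulr1 window_cst.
Qed.

End Window.

(** * Convergence to constants *)

Section Flattening.
Context {R : realType} {n : nat} {Y : finType} (Mf : Y -> 'M[R]_n.+1).
Hypothesis Mf_ge0 : forall y, nonneg_mx (Mf y).
Hypothesis Mf_markov : markov_mx (\sum_y Mf y).
Local Notation Delta := (Delta R n).
Local Notation T := (alpha_op Mf).
Implicit Types (f g h : Delta -> R) (a b v : Delta).

(** With [C] fixed by the equicontinuity, [eta] is chosen so that the error of a step
    is [z <= eps / 4]; the oscillation after [k] steps is then at most
    [(1 - p) ^ k] times the initial one, plus [2 z]. *)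
Lemma iter_window_flat m q v f (eps : R) : (0 < m)%N -> focusing Mf m q v ->
    continuous f -> 0 < eps ->
  exists l k lo hi, hi - lo <= eps /\
    forall a, lo <= iter k (window Mf m (q + l)) f a <= hi.
Proof.
move=> m0 foc cf eps0.
have e80 : 0 < eps / 8 by exact: divr_gt0.
have [B B0 fB] : exists2 B : R, 0 <= B & forall a, `|f a| <= B :=
  continuous_bounded_Delta cf.
have [C C0 fC] := continuous_cone_modulus cf e80.
have C1 : 0 < C + 1 by rewrite ltr_wpDl.
pose eta := eps / 8 / (C + 1).
have eta0 : 0 < eta by exact: divr_gt0.
have [l [p [/andP[p0 p1] minor]]] := foc eta eta0.
pose z := eps / 8 + C * eta.
have z4 : z <= eps / 4.
  have : C * eta <= eps / 8.
    rewrite /eta mulrCA -[leRHS]mulr1 ler_wpM2l ?(ltW e80)//.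
    by rewrite ler_pdivrMr// mul1r lerDl.
  rewrite /z; lra.
have step k : exists lo hi, [/\ hi - lo <= (1 - p) ^+ k * (2 * B) + 2 * z,
    cone_modulus (eps / 8) C (iter k (window Mf m (q + l)) f) &
    forall a, lo <= iter k (window Mf m (q + l)) f a <= hi].
  elim: k => [|k [lo [hi [W hC lohi]]]].
    have z0 : 0 <= z by rewrite addr_ge0 ?(ltW e80)// mulr_ge0// ltW.
    exists (- B), B; split=> //; first by rewrite expr0 mul1r; lra.
    by move=> a; rewrite -ler_norml.
  have [lo' [hi' [W' lohi']]] := window_cone_contract Mf_markov m0 C0 hC lohi minor (ltW p0).
  exists lo', hi'; split => //; last exact: window_cone_modulus.
  rewrite (le_trans W')// -/eta -/z exprS.
  have : (1 - p) * (hi - lo) <= (1 - p) * ((1 - p) ^+ k * (2 * B) + 2 * z).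
    by rewrite ler_wpM2l// subr_ge0.
  move: ((1 - p) ^+ k) => x; lra.
have [k kP] : exists k, (1 - p) ^+ k * (2 * B) <= eps / 2.
  have : (fun k => (1 - p) ^+ k * (2 * B)) @ \oo --> 0 * (2 * B).
    apply: cvgMr_tmp; apply: cvg_expr.
    by rewrite ger0_norm ?subr_ge0// ltrBlDr ltrDl.
  rewrite mul0r => /cvgr0Pnorm_le /(_ (eps / 2) (divr_gt0 eps0 (ltr0n _ 2))).
  case=> k _ /(_ k (leqnn k)) /= H; exists k; exact: le_trans (ler_norm _) H.
have [lo [hi [W _ lohi]]] := step k.
exists l, k, lo, hi; split=> //; lra.
Qed.

Definition cesaro_op N f a : R := N%:R^-1 * \sum_(k < N) iter k.+1 T f a.

Lemma iter_alpha_op_itv k f lo hi : (forall a, lo <= f a <= hi) ->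
  forall a, lo <= iter k T f a <= hi.
Proof.
move=> H a; apply/andP; split.
  rewrite -[leLHS](congr1 (@^~ a) (iter_alpha_op_cst Mf_markov k lo)).
  by apply: ler_iter_alpha_op => // b; have /andP[] := H b.
rewrite -[leRHS](congr1 (@^~ a) (iter_alpha_op_cst Mf_markov k hi)).
by apply: ler_iter_alpha_op => // b; have /andP[] := H b.
Qed.

Lemma mean_itv N (x : 'I_N -> R) lo hi : (0 < N)%N ->
  (forall k, lo <= x k <= hi) -> lo <= N%:R^-1 * \sum_(k < N) x k <= hi.
Proof.
move=> N0 H; rewrite ler_pdivlMl ?ltr0n// ler_pdivrMl ?ltr0n//.
have sumc c : N%:R * c = \sum_(k < N) c :> R by rewrite sumr_const card_ord mulr_natl.
rewrite !sumc.
by apply/andP; split; apply: ler_sum => k _; have /andP[] := H k.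
Qed.

Lemma cesaro_itv N f lo hi : (0 < N)%N -> (forall a, lo <= f a <= hi) ->
  forall a, lo <= cesaro_op N f a <= hi.
Proof. by move=> N0 H a; apply: mean_itv => // k; exact: iter_alpha_op_itv. Qed.

(** Shifting the times by one replaces a single term of the mean. *)
Lemma cesaro_shift N j f a B : (forall a, `|f a| <= B) ->
  `|cesaro_op N (iter j T f) a - cesaro_op N f a| <= j%:R * (2 * B / N%:R).
Proof.
move=> fB.
have iB k b : `|iter k T f b| <= B.
  by rewrite ler_norml iter_alpha_op_itv// => c; rewrite -ler_norml.
elim: j => [|j IH]; first by rewrite subrr normr0 mul0r.
rewrite (le_trans (ler_distD (cesaro_op N (iter j T f) a) _ _))//.
rewrite -natr1 mulrDl mul1r addrC lerD//.
rewrite /cesaro_op -mulrBr -sumrB.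
rewrite (eq_bigr (fun k : 'I_N => iter (k.+1 + j).+1 T f a - iter (k + j).+1 T f a)).
  rewrite -(big_mkord xpredT (fun k => iter (k.+1 + j).+1 T f a - iter (k + j).+1 T f a)).
  rewrite (telescope_sumr (fun k => iter (k + j).+1 T f a))// normrM.
  rewrite ger0_norm ?invr_ge0// mulrC ler_wpM2r ?invr_ge0//.
  by rewrite (le_trans (ler_normB _ _))// mulr2n mulrDl mul1r lerD.
by move=> k _; rewrite -!iterD addnS.
Qed.

Lemma iter_alpha_op_sum k m (F : 'I_m -> Delta -> R) :
  iter k T (fun b => \sum_j F j b) = fun a => \sum_j iter k T (F j) a.
Proof.
elim: k => //= k ->; apply/funext => a; rewrite /alpha_op exchange_big/=.
by apply: eq_bigr => y _; rewrite mulr_sumr.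
Qed.

Lemma cesaro_window N m q f a B : (0 < m)%N -> (forall a, `|f a| <= B) ->
  `|cesaro_op N (window Mf m q f) a - cesaro_op N f a| <= (q + m)%:R * (2 * B / N%:R).
Proof.
move=> m0 fB.
have B0 : 0 <= B := le_trans (normr_ge0 _) (fB a).
have -> : cesaro_op N (window Mf m q f) a - cesaro_op N f a =
    m%:R^-1 * \sum_(j < m) (cesaro_op N (iter (q + j) T f) a - cesaro_op N f a).
  rewrite sumrB mulrBr; congr (_ - _); last first.
    rewrite sumr_const card_ord -[cesaro_op _ _ _ *+ m]mulr_natl mulrA.
    by rewrite mulVf ?mul1r// pnatr_eq0 -lt0n.
  rewrite /cesaro_op -mulr_sumr mulrCA; congr (_ * _).
  rewrite [in RHS]exchange_big [in RHS]mulr_sumr; apply: eq_bigr => k _.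
  rewrite -[LHS]/(iter k.+1 T (fun b => m%:R^-1 * \sum_(j < m) iter (q + j) T f b) a).
  rewrite iter_alpha_opZ; congr (_ * _).
  by rewrite iter_alpha_op_sum.
rewrite normrM ger0_norm ?invr_ge0// ler_pdivrMl ?ltr0n//.
rewrite (le_trans (ler_norm_sum _ _ _))//.
rewrite (_ : m%:R * _ = \sum_(j < m) ((q + m)%:R * (2 * B / N%:R))); last first.
  by rewrite sumr_const card_ord mulr_natl.
apply: ler_sum => j _.
rewrite (le_trans (cesaro_shift _ _ _ fB))// ler_wpM2r//.
  by rewrite divr_ge0// mulr_ge0.
by rewrite ler_nat leq_add2l ltnW.
Qed.

(** The bound tends to [0] as [N] grows with [k] fixed: Cesaro means do not
    distinguish [f] from its window means. *)
Lemma cesaro_iter_window N m q k f a B : (0 < m)%N -> (forall a, `|f a| <= B) ->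
  `|cesaro_op N (iter k (window Mf m q) f) a - cesaro_op N f a| <=
    k%:R * ((q + m)%:R * (2 * B / N%:R)).
Proof.
move=> m0 fB.
have iB j b : `|iter j (window Mf m q) f b| <= B.
  elim: j b => //= j IH b; rewrite ler_norml; apply: mean_itv => // i.
  by apply: iter_alpha_op_itv => c; rewrite -ler_norml.
elim: k => [|k IH]; first by rewrite subrr normr0 mul0r.
rewrite (le_trans (ler_distD (cesaro_op N (iter k (window Mf m q) f) a) _ _))//.
rewrite -natr1 mulrDl mul1r addrC lerD//.
exact: (cesaro_window N q a m0 (iB k)).
Qed.

Definition uniform_limit (F : nat -> Delta -> R) (c : R) :=
  forall eps : R, 0 < eps ->
    exists N0, forall N a, (N0 <= N)%N -> `|F N a - c| <= eps.

(** The limit is the supremum of the lower bounds; each lower bound is at most each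
    upper bound, as both hold for large [N]. *)
Lemma flat_uniform_limit (F : nat -> Delta -> R) :
  (forall eps : R, 0 < eps -> exists N0 lo hi, hi - lo <= eps /\
     forall N a, (N0 <= N)%N -> lo <= F N a <= hi) ->
  exists c, uniform_limit F c.
Proof.
move=> H.
pose S := [set lo | exists N0 hi, forall N a, (N0 <= N)%N -> lo <= F N a <= hi].
have ubS lo hi N0 : (forall N a, (N0 <= N)%N -> lo <= F N a <= hi) -> ubound S hi.
  move=> b x [N1 [y by_]].
  have /andP[_ h1] := b (maxn N0 N1) point (leq_maxl _ _).
  have /andP[h2 _] := by_ (maxn N0 N1) point (leq_maxr _ _).
  exact: le_trans h2 h1.
have supS : has_sup S.
  have [N0 [lo [hi [_ b]]]] := H 1 ltr01.
  by split; [exists lo; exists N0, hi|exists hi; exact: ubS b].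
exists (sup S) => eps eps0; have [N0 [lo [hi [W b]]]] := H eps eps0.
have h1 : lo <= sup S by apply: ub_le_sup; [case: supS|exists N0, hi].
have h2 : sup S <= hi by apply: ge_sup; [case: supS|exact: ubS b].
exists N0 => N a /b - /(_ a) /andP[]; rewrite ler_norml; lra.
Qed.

Lemma cesaro_uniform_limit m q v f : (0 < m)%N -> focusing Mf m q v ->
  continuous f -> exists c, uniform_limit (cesaro_op^~ f) c.
Proof.
move=> m0 foc cf; apply: flat_uniform_limit => eps eps0.
have e20 : 0 < eps / 2 by exact: divr_gt0.
have e40 : 0 < eps / 4 by exact: divr_gt0.
have [l [k [lo [hi [W lohi]]]]] := iter_window_flat m0 foc cf e20.
have [B B0 fB] : exists2 B : R, 0 <= B & forall a, `|f a| <= B :=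
  continuous_bounded_Delta cf.
pose K := k%:R * ((q + l + m)%:R * (2 * B)).
have [N0 N0P] : exists N0, forall N, (N0 <= N)%N -> K / N%:R <= eps / 4.
  exists (Num.truncn (K / (eps / 4))).+1 => N N0.
  have NK : K / (eps / 4) < N%:R.
    rewrite (lt_le_trans (truncnS_gt _))// ler_nat//.
  have N1 : 0 < N%:R :> R by rewrite ltr0n (leq_trans _ N0).
  by rewrite ler_pdivrMr// mulrC -ler_pdivrMr// ltW.
exists N0.+1, (lo - eps / 4), (hi + eps / 4); split; first lra.
move=> N a NN.
have := cesaro_iter_window N (q + l) k a m0 fB; rewrite !mulrA -[_ * 2]mulrA.
have := N0P N (ltnW NN); rewrite /K !mulrA => h1 h2.
have := le_trans h2 h1; rewrite ler_norml.
have /(_ a)/andP[] := cesaro_itv (leq_ltn_trans (leq0n _) NN) lohi; lra.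
Qed.

Lemma iter_uniform_limit q v f : focusing Mf 1 q v ->
  continuous f -> exists c, uniform_limit (fun N => iter N T f) c.
Proof.
move=> foc cf; apply: flat_uniform_limit => eps eps0.
have [l [k [lo [hi [W lohi]]]]] := iter_window_flat (ltn0Sn 0) foc cf eps0.
have windowE g : window Mf 1 (q + l) g = iter (q + l) T g.
  by apply/funext => a; rewrite /window invr1 mul1r big_ord1 addn0.
have iterE : iter k (window Mf 1 (q + l)) f = iter (k * (q + l)) T f.
  by elim: k {W lohi} => //= k ->; rewrite windowE -iterD mulSn.
exists (k * (q + l))%N, lo, hi; split=> // N a NN.
rewrite -(subnK NN) iterD -iterE; exact: iter_alpha_op_itv.
Qed.

End Flattening.

(** * Focusing from irreducibility or aperiodicity *)

Section Focusing.
Context {R : realType} {n : nat} {Y : finType} (Mf : Y -> 'M[R]_n.+1).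
Hypothesis Mf_ge0 : forall y, nonneg_mx (Mf y).
Hypothesis Mf_markov : markov_mx (\sum_y Mf y).
Local Notation M := (\sum_y Mf y).

Lemma finite_pos_lbound (I : finType) (F : I -> R) : (forall i, 0 < F i) ->
  exists2 d : R, 0 < d & forall i, d <= F i.
Proof.
move=> F0; exists (\big[Num.min/1]_i F i) => [|i]; last exact: bigmin_le_cond.
by apply: lt_bigmin => [|i _]; [exact: ltr01|exact: F0].
Qed.

Lemma nonneg_exp k : nonneg_mx (M ^+ k).
Proof.
elim: k => [|k IH] i j; first by rewrite expr0 mxE ler0n.
rewrite exprS mxE sumr_ge0// => l _.
by rewrite mulr_ge0//; exact: (proj1 Mf_markov).
Qed.

(** The window is long enough to contain, for each pair of states, a time at which
    the entry is positive. *)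
Lemma irreducible_sum_gt0 : irreducible_mx M ->
  exists2 m, (0 < m)%N & forall i k, 0 < \sum_(j < m) (M ^+ j) i k.
Proof.
move=> irr; pose K i k := projT1 (cid (irr i k)).
exists (\max_(x : 'I_n.+1 * 'I_n.+1) K x.1 x.2).+1 => // i k.
have le : (K i k < (\max_(x : 'I_n.+1 * 'I_n.+1) K x.1 x.2).+1)%N.
  by rewrite ltnS (leq_bigmax (i, k)).
rewrite (bigD1 (Ordinal le))//= ltr_pwDl//.
  by rewrite /K; case: cid.
by rewrite sumr_ge0// => j _; exact: nonneg_exp.
Qed.

Lemma rank1_focusing m q : (0 < m)%N ->
    (forall i k, 0 < \sum_(j < m) (M ^+ (q + j)) i k) ->
    (exists2 A, closure (mx_cone Mf) A & \rank A = 1%N) ->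
  exists v, focusing Mf m q v.
Proof.
move=> m0 S0 [A clA rA].
have A0 : nonneg_mx A.
  move=> i j; apply/ler_addgt0Pl => e e0.
  have [_ [c /= c0 [_ [w _ <-] <-]] AB] := closure_entrywise clA e0.
  have := AB i j; rewrite mxE.
  have : 0 <= c * (\prod_(y <- w) Mf y) i j.
    by rewrite mulr_ge0 ?(ltW c0)//; exact: word_nonneg.
  by rewrite ltr_norml => h1 /andP[h2 _]; lra.
have [v [i0 [ui0 AE]]] := rank1_nonneg_factor A0 rA.
have u0 i : 0 <= \sum_k A i k by rewrite sumr_ge0// => k _; exact: A0.
have [d d0 dS] := finite_pos_lbound (fun x : 'I_n.+1 * 'I_n.+1 => S0 x.1 x.2).
have mR : 0 < m%:R :> R by rewrite ltr0n.
exists v; apply: (window_focusing Mf_ge0 Mf_markov m0 (divr_gt0 d0 mR) _ clA AE u0 ui0).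
move=> a; rewrite divfK ?gt_eqF//.
rewrite (_ : \sum_j _ = \sum_k val a 0 k * \sum_(j < m) (M ^+ (q + j)) k i0).
  rewrite -[leLHS]mul1r -(Delta_sum1 a) mulr_suml; apply: ler_sum => k _.
  by rewrite ler_wpM2l ?Delta_ge0//; exact: (dS (k, i0)).
under eq_bigr do rewrite mxE.
by rewrite exchange_big/=; apply: eq_bigr => k _; rewrite mulr_sumr.
Qed.

Lemma irreducible_cesaro_limit f :
    irreducible_mx M -> (exists2 A, closure (mx_cone Mf) A & \rank A = 1%N) ->
  continuous f -> exists c, uniform_limit (fun N => cesaro_op Mf N f) c.
Proof.
move=> irr rk cf; have [m m0 S0] := irreducible_sum_gt0 irr.
have [v foc] := @rank1_focusing m 0 m0 S0 rk.
exact: (cesaro_uniform_limit Mf_ge0 Mf_markov m0 foc cf).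
Qed.

Lemma aperiodic_iter_limit f :
    aperiodic_mx M -> (exists2 A, closure (mx_cone Mf) A & \rank A = 1%N) ->
  continuous f -> exists c, uniform_limit (fun N => iter N (alpha_op Mf) f) c.
Proof.
move=> [k k0] rk cf.
have [|v foc] := @rank1_focusing 1 k (ltn0Sn 0) _ rk.
  by move=> i j; rewrite big_ord1 addn0.
exact: (iter_uniform_limit Mf_ge0 Mf_markov foc cf).
Qed.

End Focusing.

(** * Integrals of continuous functions *)

Section IntegralsOverDelta.
Context {R : realType} {n : nat}.
Local Notation Delta := (Delta R n).
Implicit Types (P : probability Delta R) (f g : Delta -> R).

Lemma continuous_finite_integrable (mu : {measure set Delta -> \bar R}) f :
  (mu setT < +oo)%E -> continuous f -> mu.-integrable setT (EFin \o f).
Proof.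
move=> muT cf; have [C C0 fC] := continuous_bounded_Delta cf.
apply: measurable_bounded_integrable => //.
  exact: continuous_measurable_Delta.
exists C; split=> [|x Cx a _ /=]; first exact: num_real.
exact: le_trans (fC a) (ltW Cx).
Qed.

Lemma continuous_integrable P f : continuous f -> P.-integrable setT (EFin \o f).
Proof.
apply: continuous_finite_integrable.
by rewrite [X in (X < _)%E]probability_setT ltry.
Qed.

Lemma integral_cst_probability P c : \int[P]_a c = c.
Proof. by rewrite Rintegral_cst// [X in fine X]probability_setT mulr1. Qed.

Lemma ler_integral_Delta P f g : continuous f -> continuous g ->
  (forall a, f a <= g a) -> \int[P]_a f a <= \int[P]_a g a.
Proof. by move=> cf cg fg; apply: le_Rintegral => //; exact: continuous_integrable. Qed.

Lemma integralD_Delta P f g : continuous f -> continuous g ->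
  \int[P]_a (f a + g a) = \int[P]_a f a + \int[P]_a g a.
Proof. by move=> cf cg; rewrite RintegralD//; exact: continuous_integrable. Qed.

Lemma integralZ_Delta P c f : continuous f ->
  \int[P]_a (c * f a) = c * \int[P]_a f a.
Proof. by move=> cf; rewrite RintegralZl//; exact: continuous_integrable. Qed.

Lemma integral_sum_Delta P m (F : 'I_m -> Delta -> R) :
  (forall k, continuous (F k)) ->
  \int[P]_a (\sum_k F k a) = \sum_k \int[P]_a F k a.
Proof.
move=> cF; elim: m F cF => [|m IH] F cF.
  under eq_Rintegral do rewrite big_ord0.
  by rewrite big_ord0 integral_cst_probability.
under eq_Rintegral do rewrite big_ord_recl.
rewrite integralD_Delta//; first by rewrite big_ord_recl IH.
by apply: continuous_sum_Delta => i; exact: cF.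
Qed.

End IntegralsOverDelta.

(** * Representation of positive functionals by measures *)

Section Riesz.
Context {R : realType} {n : nat}.
Local Notation Delta := (Delta R n).
Implicit Types (f g : Delta -> R) (a b : Delta) (A B : set Delta).

Variable L : (Delta -> R) -> R.
Hypothesis LD : forall f g, continuous f -> continuous g ->
  L (fun a => f a + g a) = L f + L g.
Hypothesis LZ : forall c f, continuous f -> L (fun a => c * f a) = c * L f.
Hypothesis L_ge0 : forall f, continuous f -> (forall a, 0 <= f a) -> 0 <= L f.
Hypothesis L1 : L (fun=> 1) = 1.

Let LB f g : continuous f -> continuous g -> L (fun a => f a - g a) = L f - L g.
Proof.
move=> cf cg; rewrite -[in RHS]mulN1r -LZ// -LD//.
  by congr L; apply/funext => a; rewrite mulN1r.
exact: continuousZ_Delta.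
Qed.

Let Lcst c : L (fun=> c) = c.
Proof.
rewrite -[RHS]mulr1 -L1 -LZ; last exact: continuous_cst_Delta.
by congr L; apply/funext => a; rewrite mulr1.
Qed.

Let ler_L f g : continuous f -> continuous g -> (forall a, f a <= g a) -> L f <= L g.
Proof.
move=> cf cg fg; rewrite -subr_ge0 -LB//; apply: L_ge0 => [|a].
  exact: continuousB_Delta.
by rewrite subr_ge0.
Qed.

Let L_sum (I : Type) (r : seq I) (F : I -> Delta -> R) :
  (forall i, continuous (F i)) ->
  L (fun a => \sum_(i <- r) F i a) = \sum_(i <- r) L (F i).
Proof.
move=> cF; elim: r => [|i r IH].
  rewrite big_nil -[RHS](Lcst 0); congr L.
  by apply/funext => a; rewrite big_nil.
rewrite big_cons -IH -LD//; last exact: continuous_sum_Delta.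
by congr L; apply/funext => a; rewrite big_cons.
Qed.

(** The set [A] is covered by an increasing sequence of nonnegative continuous
    functions that reaches [1] on [A] in the limit and has integrals at most [c];
    the least such [c] is the outer measure of [A].  Countable covers by sums of
    functions are encoded by their partial sums, which keeps all values real. *)
Definition dominated A c := exists h : nat -> Delta -> R,
  [/\ forall k, continuous (h k), forall k a, 0 <= h k a,
      forall a, {homo h^~ a : k l / (k <= l)%N >-> k <= l},
      forall k, L (h k) <= c &
      forall a, A a -> forall e, 0 < e -> exists k, 1 - e <= h k a].

Lemma dominated_ge0 A c : dominated A c -> 0 <= c.
Proof. by move=> [h [ch h0 _ hc _]]; apply: le_trans (hc 0); exact: L_ge0. Qed.

Lemma dominated_sub A B c : A `<=` B -> dominated B c -> dominated A c.
Proof. by move=> AB [h [ch h0 hh hc hB]]; exists h; split=> // a /AB; exact: hB. Qed.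

Lemma dominated_cst A f : continuous f -> (forall a, 0 <= f a) ->
  (forall a, A a -> 1 <= f a) -> dominated A (L f).
Proof.
move=> cf f0 fA; exists (fun=> f); split=> // [a k l _ //|a Aa e e0]; exists 0%N.
by apply: le_trans (fA a Aa); rewrite gerBl ltW.
Qed.

Lemma dominated1 A : dominated A 1.
Proof. by rewrite -L1; apply: dominated_cst => //; exact: continuous_cst_Delta. Qed.

(** The [m]-th function of the union is the sum of the [m]-th functions of the first
    [m] covers. *)
Lemma dominated_bigcup (F : nat -> set Delta) (x : nat -> R) c :
  (forall i, dominated (F i) (x i)) -> (forall m, \sum_(i < m) x i <= c) ->
  dominated (\bigcup_i F i) c.
Proof.
move=> /choice[h hP] xc.
exists (fun m a => \sum_(i < m) h i m a); split.
- move=> m; apply: continuous_sum_Delta => i; by have [] := hP i.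
- by move=> m a; apply: sumr_ge0 => i _; have [_ h0 _ _ _] := hP i; exact: h0.
- move=> a k l kl; rewrite -(subnKC kl) big_split_ord/= subnKC//.
  apply: ler_wpDr; first by apply: sumr_ge0 => i _; have [_ h0 _ _ _] := hP (k + i)%N; exact: h0.
  by apply: ler_sum => i _; have [_ _ hh _ _] := hP i; exact: hh.
- move=> m; rewrite L_sum => [|i]; last by have [] := hP i.
  rewrite (le_trans _ (xc m))//; apply: ler_sum => i _.
  by have [_ _ _ hx _] := hP i; exact: hx.
move=> a [i _ Fia] e e0.
have [_ h0 hh _ /(_ a Fia e e0)[k hk]] := hP i.
exists (maxn i.+1 k); rewrite (le_trans hk)//.
have ik : (i < maxn i.+1 k)%N by exact: leq_maxl.
rewrite (le_trans (hh _ _ _ (leq_maxr i.+1 k)))// (bigD1 (Ordinal ik))//= lerDl.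
by apply: sumr_ge0 => j _; have [_ h0' _ _ _] := hP j; exact: h0'.
Qed.

(** With [phi_k] increasing to the indicator of [U], the functions [h_k phi_k] cover
    [A] inside [U] at a cost [x], the supremum of their integrals.  If [J] almost
    attains it, the functions [h_k - h_J phi_J] cover [A] outside [U], where
    [phi_J] vanishes, and they cost only the difference. *)
Lemma dominated_open_split A U c e : open U -> dominated A c -> 0 < e ->
  exists x y, [/\ dominated (A `&` U) x, dominated (A `&` ~` U) y & x + y <= c + e].
Proof.
move=> oU [h [ch h0 hh hc hA]] e0.
have [phi [cphi phi01 phihomo phi0 phi1]] := open_indicator_approx oU.
have phi_ge0 k a : 0 <= phi k a by case/andP: (phi01 k a).
have phi_le1 k a : phi k a <= 1 by case/andP: (phi01 k a).
pose H k a := h k a * phi k a.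
have cH k : continuous (H k) by exact: continuousM_Delta.
have Hh k a : H k a <= h k a by rewrite ler_piMr.
have H0 k a : 0 <= H k a by exact: mulr_ge0.
have Hhomo k l a : (k <= l)%N -> H k a <= H l a.
  by move=> kl; rewrite ler_pM// ?hh ?phihomo.
pose S := [set L (H k) | k in [set: nat]].
have supS : has_sup S.
  split; first by exists (L (H 0%N)), 0%N.
  by exists c => _ [k _ <-]; apply: le_trans (hc k); exact: ler_L.
have [_ [J _ <-] HJ] := sup_adherent e0 supS.
exists (sup S), (c - L (H J)); split; last lra.
  exists H; split => //.
  - by move=> a k l; exact: Hhomo.
  - by move=> k; apply: ub_le_sup; [case: supS|exists k].
  move=> a [Aa Ua] d d0; have [k hk] := hA a Aa d d0.
  have [k0 k0P] := phi1 a Ua; exists (maxn k k0).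
  by rewrite /H k0P ?leq_maxr// mulr1 (le_trans hk)// hh// leq_maxl.
exists (fun k a => h (k + J)%N a - H J a); split.
- by move=> k; exact: continuousB_Delta.
- move=> k a; rewrite subr_ge0 (le_trans (Hh _ _))// hh//; exact: leq_addl.
- by move=> a k l kl; rewrite lerB// hh// leq_add2r.
- by move=> k; rewrite LB// lerB.
move=> a [Aa Ua] d d0; have [k hk] := hA a Aa d d0; exists k.
have -> : H J a = 0 by rewrite /H phi0// mulr0.
by rewrite subr0 (le_trans hk)// hh// leq_addr.
Qed.

(** By compactness, an increasing sequence that reaches [1] everywhere in the limit
    exceeds [1 - e] everywhere at some stage (as in the theorem of Dini). *)
Lemma dominated_setT_ge1 c : dominated setT c -> 1 <= c.
Proof.
move=> [h [ch h0 hh hc hT]]; apply/ler_addgt0Pl => e e0; rewrite addrC -lerBlDr.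
have e20 : 0 < e / 2 by exact: divr_gt0.
have /compact_near_coveringP/(_ _ \oo (fun k a => 1 - e <= h k a)) :=
  @compact_Delta R n.
case=> [a _|N _ /(_ N (leqnn N)) hN].
  have [k hk] := hT a I (e / 2) e20.
  have [d d0 dP] := (continuous_dist1P (h k)).1 (ch k) a (e / 2) e20.
  exists ([set b | dist1 a b < d], [set l | (k <= l)%N]) => /=.
    by split; [exact: near_dist1|exists k].
  move=> [b l]/= [/dP ab kl]; rewrite (le_trans _ (hh b _ _ kl))//.
  by move: ab; rewrite ltr_norml => /andP[]; lra.
rewrite -(Lcst (1 - e)) (le_trans _ (hc N))// ler_L//.
  exact: continuous_cst_Delta.
by move=> a; exact: hN.
Qed.

Definition riesz_outer A : \bar R := (inf [set c | dominated A c])%:E.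

Let has_inf_dom A : has_inf [set c | dominated A c].
Proof.
by split; [exists 1; exact: dominated1|exists 0 => c; exact: dominated_ge0].
Qed.

Lemma riesz_outer_le A c : dominated A c -> (riesz_outer A <= c%:E)%E.
Proof. by move=> Ac; rewrite lee_fin; apply: ge_inf => //; case: (has_inf_dom A). Qed.

Lemma riesz_outer_adherent A e : 0 < e ->
  exists2 c, dominated A c & (c%:E <= riesz_outer A + e%:E)%E.
Proof.
move=> e0; have [c Ac ce] := inf_adherent e0 (has_inf_dom A).
by exists c => //; rewrite -EFinD lee_fin ltW.
Qed.

Let riesz_outer_ge0 A : (0 <= riesz_outer A)%E.
Proof.
by rewrite lee_fin; apply: lb_le_inf => [|c]; [case: (has_inf_dom A)|exact: dominated_ge0].
Qed.

Let riesz_outer0 : riesz_outer set0 = 0%E.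
Proof.
apply/eqP; rewrite eq_le riesz_outer_ge0 andbT; apply: riesz_outer_le.
by rewrite -(Lcst 0); apply: dominated_cst => //; exact: continuous_cst_Delta.
Qed.

Let le_riesz_outer : {homo riesz_outer : A B / A `<=` B >-> (A <= B)%E}.
Proof.
move=> A B AB; rewrite lee_fin; apply: lb_le_inf => [|c Bc].
  by case: (has_inf_dom B).
by apply: ge_inf; [case: (has_inf_dom A)|exact: dominated_sub Bc].
Qed.

Let riesz_outer_sigma_subadditive : sigma_subadditive riesz_outer.
Proof.
move=> F; set S := (\sum_(i <oo) _)%E.
have S0 : (0 <= S)%E by exact: nneseries_ge0.
have [->|Soo] := eqVneq S +oo%E; first by rewrite leey.
have Sfin : S \is a fin_num by rewrite ge0_fin_numE// ltey.
apply/lee_addgt0Pr => e e0.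
have ei i : 0 < e / (2 ^ i.+1)%:R by rewrite divr_gt0// ltr0n expn_gt0.
have /choice[x xP] : forall i, exists c, dominated (F i) c /\
    (c%:E <= riesz_outer (F i) + (e / (2 ^ i.+1)%:R)%:E)%E.
  by move=> i; have [c] := riesz_outer_adherent (F i) (ei i); exists c.
rewrite -(fineK Sfin) -EFinD; apply: riesz_outer_le.
apply: (@dominated_bigcup _ x) => [i|m]; first by have [] := xP i.
rewrite -lee_fin EFinD fineK// -sumEFin.
apply: le_trans (epsilon_trick xpredT (fun i => riesz_outer_ge0 (F i)) (ltW e0)).
apply: le_trans (nneseries_lim_ge m _); last first.
  by move=> i _ _; rewrite adde_ge0// lee_fin ltW.
by rewrite big_mkord; apply: lee_sum => i _; have [] := xP i.
Qed.

HB.instance Definition _ := isOuterMeasure.Build R Delta riesz_outer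
  riesz_outer0 riesz_outer_ge0 le_riesz_outer riesz_outer_sigma_subadditive.

Lemma measurable_riesz_outer A : measurable A -> riesz_outer.-cara.-measurable A.
Proof.
move: A; apply: smallest_sub.
  split => //; first by move=> X mX; rewrite setTD; exact: measurableC.
  by move=> F mF; exact: bigcupT_measurable.
move=> U oU; apply: le_caratheodory_measurable => X.
apply/lee_addgt0Pr => e e0.
have e20 : 0 < e / 2 by exact: divr_gt0.
have [c Xc ce] := riesz_outer_adherent X e20.
have [x [y [Xx Xy xy]]] := dominated_open_split oU Xc e20.
apply: (@le_trans _ _ (x + y)%:E).
  by rewrite EFinD leeD//; exact: riesz_outer_le.
apply: (@le_trans _ _ (c + e / 2)%:E); first by rewrite lee_fin.
rewrite EFinD [in leRHS](splitr e) EFinD addeA leeD2r//.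
Qed.

Definition riesz_measure : set Delta -> \bar R := riesz_outer.

Let riesz_measure_sigma_additive : semi_sigma_additive riesz_measure.
Proof.
move=> F mF tF mUF.
apply: (@caratheodory_measure_sigma_additive _ _ riesz_outer) => //.
  by move=> i; exact: measurable_riesz_outer.
exact: measurable_riesz_outer.
Qed.

HB.instance Definition _ := isMeasure.Build _ Delta R riesz_measure
  riesz_outer0 riesz_outer_ge0 riesz_measure_sigma_additive.

Let riesz_measureT : riesz_measure setT = 1%E.
Proof.
apply/eqP; rewrite eq_le; apply/andP; split.
  by apply: riesz_outer_le; exact: dominated1.
rewrite lee_fin; apply: lb_le_inf => [|c]; last exact: dominated_setT_ge1.
by case: (has_inf_dom setT).
Qed.

HB.instance Definition _ :=
  Measure_isProbability.Build _ Delta R riesz_measure riesz_measureT.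

(** The part of [N f] between the heights [i] and [i + 1]. *)
Let level (N i : nat) f a := Num.min i.+1%:R (N%:R * f a) - Num.min i%:R (N%:R * f a).

Let continuous_level N i f : continuous f -> continuous (level N i f).
Proof.
move=> cf; apply: continuousB_Delta; apply: continuous_min_Delta;
  exact: continuousZ_Delta.
Qed.

Let level_ge0 N i f a : 0 <= level N i f a.
Proof. by rewrite subr_ge0 le_min2// ler_nat. Qed.

Let level_le1 N i f a : level N i f a <= 1.
Proof.
rewrite /level -natr1 /Num.min; move: (N%:R * f a) i%:R => x y.
by case: (ltP (y + 1) x); case: (ltP y x); lra.
Qed.

(** The slice [i + 1] is at most [1], and vanishes unless [N f >= i + 1]; there the
    slice [i] equals [1], so the functional of that slice bounds the measure of
    this set. *)
Let integral_levelS (P : probability Delta R) N i f : continuous f ->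
  (forall A, measurable A -> P A = riesz_outer A) ->
  \int[P]_a level N i.+1 f a <= L (level N i f).
Proof.
move=> cf PE.
pose A := (fun a => N%:R * f a) @^-1` `[i.+1%:R, +oo[.
have mA : measurable A.
  rewrite -[A]setTI.
  have := continuous_measurable_Delta (continuousZ_Delta (c := N%:R) cf).
  by apply => //; exact: measurable_itv.
have AL : (P A <= (L (level N i f))%:E)%E.
  rewrite PE//; apply: riesz_outer_le; apply: dominated_cst => //.
    exact: continuous_level.
  move=> a; rewrite /A/= in_itv/= andbT => Aa.
  rewrite /level !(min_idPl _)//; first by rewrite -natr1 addrC addKr.
  by rewrite (le_trans _ Aa)// ler_nat.
rewrite -lee_fin (le_trans _ AL)// /Rintegral fineK; last first.
  by apply: integrable_fin_num => //; apply: continuous_integrable; exact: continuous_level.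
have <- : (\int[P]_a (\1_A a)%:E = P A)%E by rewrite integral_indic// setIT.
apply: ge0_le_integral => //.
- by move=> a _; rewrite lee_fin.
- apply/measurable_EFinP.
  exact: (continuous_measurable_Delta (@continuous_level N i.+1 f cf)).
- by apply/measurable_EFinP; exact: measurable_indic.
move=> a _; rewrite lee_fin indicE; have [aA|aA] := boolP (a \in A) => //.
rewrite /level !(min_idPr _) ?subrr//.
  by move: aA; rewrite notin_setE /A/= in_itv/= andbT => /negP; rewrite -ltNge => /ltW.
move: aA; rewrite notin_setE /A/= in_itv/= andbT => /negP; rewrite -ltNge => /ltW /le_trans; apply.
by rewrite ler_nat.
Qed.

(** Comparing each slice with the one below it leaves only the lowest slice, whose
    contribution to [f] is at most [1 / N]. *)
Let integral_le_riesz (P : probability Delta R) f : continuous f ->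
  (forall A, measurable A -> P A = riesz_outer A) ->
  (forall a, 0 <= f a <= 1) -> \int[P]_a f a <= L f.
Proof.
move=> cf PE f01; apply/ler_addgt0Pl => e e0.
pose N := (Num.truncn e^-1).+1.
have N0 : 0 < N%:R :> R by rewrite ltr0n.
have Ne : 1 <= e * N%:R.
  by rewrite -ler_pdivrMl// mulr1 ltW// truncnS_gt.
have NfE : (fun a => N%:R * f a) = fun a => \sum_(i < N) level N i f a.
  apply/funext => a; rewrite -(big_mkord xpredT (fun i => level N i f a)).
  rewrite (telescope_sumr (fun i => Num.min i%:R (N%:R * f a)))//.
  have /andP[fa0 fa1] := f01 a.
  rewrite (min_idPr _) ?(min_idPl _) ?subr0//; first by rewrite mulr_ge0.
  by rewrite -[leRHS]mulr1 ler_wpM2l// ltW.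
rewrite -(ler_pM2l N0) -integralZ_Delta// NfE integral_sum_Delta; last first.
  by move=> i; exact: continuous_level.
rewrite mulrDr -LZ// NfE L_sum; last by move=> i; exact: continuous_level.
rewrite big_ord_recl (big_ord_recr _ (fun i : 'I_N => L _))/= lerD//.
  rewrite mulrC (le_trans _ Ne)// -[leRHS](integral_cst_probability P).
  apply: ler_integral_Delta => //; first exact: continuous_level.
  exact: continuous_cst_Delta.
rewrite ler_wpDr//; first by apply: L_ge0 => //; exact: continuous_level.
by apply: ler_sum => i _; exact: integral_levelS.
Qed.

(** An upper bound for all continuous functions with values in [[0, 1]] extends to all
    continuous functions by an affine rescaling; applied to [- f] it becomes the
    lower bound. *)
Lemma riesz_representation : exists P : probability Delta R,
  forall f, continuous f -> \int[P]_a f a = L f.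
Proof.
exists riesz_measure => f cf; set P : probability Delta R := riesz_measure.
have PE A : measurable A -> P A = riesz_outer A by [].
have [C C0 fC] := continuous_bounded_Delta cf.
have C1 : 0 < C + 1 by rewrite ltr_wpDl.
pose c := (2 * (C + 1))^-1.
have c0 : 0 < c by rewrite invr_gt0 mulr_gt0.
have cE : c * (2 * (C + 1)) = 1 by rewrite mulVf// gt_eqF// mulr_gt0.
have le g : continuous g -> (forall a, `|g a| <= C) -> \int[P]_a g a <= L g.
  move=> cg gC.
  have ccg : continuous (fun a => c * g a) by exact: continuousZ_Delta.
  have cc := @continuous_cst_Delta R n (1 / 2).
  have := @integral_le_riesz P (fun a => c * g a + 1 / 2) _ PE.
  rewrite (integralD_Delta P ccg cc) (LD ccg cc) Lcst LZ// integralZ_Delta//.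
  rewrite integral_cst_probability.
  rewrite lerD2r ler_pM2l//; apply.
    exact: continuousD_Delta.
  move=> a; have : `|c * g a| <= 1 / 2.
    rewrite normrM (gtr0_norm c0) (@le_trans _ _ (c * (C + 1)))//; last lra.
    by rewrite ler_pM2l// (le_trans (gC a))// lerDl.
  by rewrite ler_norml; lra.
apply/eqP; rewrite eq_le le//=.
have cNf : continuous (fun a => (-1) * f a) by exact: continuousZ_Delta.
have := le (fun a => (-1) * f a) cNf.
rewrite integralZ_Delta// LZ// !mulN1r lerN2; apply => a.
by rewrite mulN1r normrN.
Qed.

End Riesz.

(** * Measures tested on continuous functions *)

Section MeasureDetermination.
Context {R : realType} {n : nat}.
Local Notation Delta := (Delta R n).

(** Open sets generate the Borel sets and are stable under intersection; the
    indicator of an open set is an increasing limit of continuous functions. *)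
Lemma probability_eq_continuous (P Q : probability Delta R) :
  (forall f : Delta -> R, continuous f -> \int[P]_a f a = \int[Q]_a f a) -> P ≡μ Q.
Proof.
move=> PQ.
suff openPQ (U : set Delta) : open U -> P U = Q U.
  move=> A mA; apply: (measure_unique (@open Delta) (fun=> setT)) mA => //.
  - by move=> X Y; exact: openI.
  - by move=> _; exact: openT.
  - by rewrite bigcup_const.
  - by move=> _; rewrite [X in (X < _)%E]probability_setT ltry.
move=> oU; have [phi [cphi phi01 phihomo phi0 phi1]] := open_indicator_approx oU.
have mU : measurable U by exact: sub_sigma_algebra.
have limphi a : limn (fun k => (phi k a)%:E) = (\1_U a)%:E.
  apply: cvg_lim => //; rewrite indicE; have [aU|aU] := boolP (a \in U).
    have [k0 k0P] := phi1 a (set_mem aU).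
    by apply: cvg_near_cst; exists k0 => // k /= kl; rewrite k0P.
  apply: cvg_near_cst; apply: nearW => k; rewrite phi0//.
  by move: aU; rewrite notin_setE.
have cvgU (S : probability Delta R) :
    (\int[S]_a (phi k a)%:E)%E @[k --> \oo] --> S U.
  rewrite (_ : S U = (\int[S]_a limn (fun k => (phi k a)%:E))%E); last first.
    by under eq_integral do rewrite limphi; rewrite integral_indic// setIT.
  apply: (@cvg_monotone_convergence _ _ _ S setT measurableT (fun k a => (phi k a)%:E)).
  - by move=> k; apply/measurable_EFinP; exact: continuous_measurable_Delta (cphi k).
  - by move=> k a _; rewrite lee_fin; case/andP: (phi01 k a).
  - by move=> a _ k l kl; rewrite lee_fin phihomo.
have fin (S : probability Delta R) k : (\int[S]_a (phi k a)%:E)%E = (\int[S]_a phi k a)%:E.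
  by rewrite fineK//; apply: integrable_fin_num => //; exact: continuous_integrable.
have PQk k : (\int[P]_a (phi k a)%:E)%E = (\int[Q]_a (phi k a)%:E)%E by rewrite !fin PQ.
have := cvgU P; under eq_fun do rewrite PQk.
by move=> cP; exact: (cvg_unique _ cP (cvgU Q)).
Qed.

(** Integrals against a finite sum of measures are additive for nonnegative functions;
    adding a constant makes [f] nonnegative. *)
Lemma integral_cesaro_mean (P : nat -> probability Delta R) N (f : Delta -> R) :
  continuous f ->
  \int[cesaro_mean (fun k => P k) N]_a f a = N%:R^-1 * \sum_(k < N) \int[P k.+1]_a f a.
Proof.
move=> cf; have [C C0 fC] := continuous_bounded_Delta cf.
pose m := cesaro_mean (fun k => P k) N.
have mf := continuous_measurable_Delta cf.
have ge0 (g : Delta -> R) : continuous g -> (forall a, 0 <= g a) ->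
    (\int[m]_a (g a)%:E)%E = (N%:R^-1 * \sum_(k < N) \int[P k.+1]_a g a)%:E.
  move=> cg g0.
  have mg := continuous_measurable_Delta cg.
  rewrite ge0_integral_mscale//=; last 2 first.
    exact/measurable_EFinP.
    by move=> a _; rewrite lee_fin.
  rewrite ge0_integral_measure_sum//; last 2 first.
    by move=> a _; rewrite lee_fin.
    exact/measurable_EFinP.
  rewrite EFinM -sumEFin; congr (_ * _)%E; apply: eq_bigr => k _.
  by rewrite fineK//; apply: integrable_fin_num => //; exact: continuous_integrable.
have cc := @continuous_cst_Delta R n.
have mT c : 0 <= c -> (\int[m]_a c%:E)%E = (N%:R^-1 * \sum_(k < N) c)%:E.
  move=> c0; rewrite (ge0 (fun=> c) (cc c))//; congr (_ * _)%:E.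
  by apply: eq_bigr => k _; rewrite integral_cst_probability.
have moo : (m setT < +oo)%E.
  by rewrite -[m setT]mul1e -integral_cst// (mT 1 ler01) ltry.
have mC := continuous_finite_integrable moo (cc C).
have mif := continuous_finite_integrable moo cf.
have split : \int[m]_a (f a + C) = \int[m]_a f a + \int[m]_a C by rewrite RintegralD.
have : \int[m]_a (f a + C) = N%:R^-1 * \sum_(k < N) (\int[P k.+1]_a f a + C).
  rewrite /Rintegral ge0/=; last 2 first.
    exact: continuousD_Delta.
    by move=> a; have := fC a; rewrite ler_norml => /andP[]; lra.
  congr (_ * _); apply: eq_bigr => k _.
  by rewrite integralD_Delta// integral_cst_probability.
rewrite split big_split mulrDr /= [X in _ + X = _]/Rintegral mT//= => /addIr.
by [].
Qed.

End MeasureDetermination.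

(** * The stationary distribution *)

Section ErgodicTheorem.
Context {R : realType} {n : nat} {Y : finType} (Mf : Y -> 'M[R]_n.+1).
Hypothesis Mf_ge0 : forall y, nonneg_mx (Mf y).
Hypothesis Mf_markov : markov_mx (\sum_y Mf y).
Local Notation Delta := (Delta R n).
Local Notation T := (alpha_op Mf).
Implicit Types (f g : Delta -> R) (a b : Delta) (mu nu P : probability Delta R).

Lemma integral_iter_adjoint k mu f : continuous f ->
  \int[iter k (alpha_adjoint Mf) mu]_a f a = \int[mu]_a iter k T f a.
Proof.
elim: k f => // k IH f cf; rewrite iterS (alpha_adjointP Mf_ge0 Mf_markov)//.
rewrite IH; last exact: continuous_alpha_op.
by apply: eq_Rintegral => a _; rewrite -iterSr.
Qed.

Lemma stationary_integral nu f : stationary Mf nu -> continuous f ->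
  \int[nu]_a T f a = \int[nu]_a f a.
Proof.
move=> st cf; rewrite -(alpha_adjointP Mf_ge0 Mf_markov)// /Rintegral.
by congr fine; apply: eq_measure_integral => A mA _; exact: st.
Qed.

Lemma continuous_cesaro_op N f : continuous f -> continuous (cesaro_op Mf N f).
Proof.
move=> cf; apply: continuousZ_Delta; apply: continuous_sum_Delta => k.
exact: continuous_iter_alpha_op.
Qed.

Lemma integral_cesaro_op N mu f : continuous f ->
  \int[mu]_a cesaro_op Mf N f a = N%:R^-1 * \sum_(k < N) \int[mu]_a iter k.+1 T f a.
Proof.
move=> cf; rewrite integralZ_Delta; last first.
  by apply: continuous_sum_Delta => k; exact: continuous_iter_alpha_op.
by rewrite integral_sum_Delta// => k; exact: continuous_iter_alpha_op.
Qed.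

Lemma uniform_limit_integral (F : nat -> Delta -> R) c mu :
  (forall N, continuous (F N)) -> uniform_limit F c ->
  \int[mu]_a F N a @[N --> \oo] --> c.
Proof.
move=> cF Fc; apply/cvgrPdist_le => e e0; have [N0 N0P] := Fc e e0.
exists N0 => // N /= NN.
have bd a : c - e <= F N a <= c + e by have := N0P N a NN; rewrite ler_norml; lra.
have lo : c - e <= \int[mu]_a F N a.
  rewrite -[leLHS](integral_cst_probability mu); apply: ler_integral_Delta => //.
    exact: continuous_cst_Delta.
  by move=> a; have /andP[] := bd a.
have hi : \int[mu]_a F N a <= c + e.
  rewrite -[leRHS](integral_cst_probability mu); apply: ler_integral_Delta => //.
    exact: continuous_cst_Delta.
  by move=> a; have /andP[] := bd a.
by rewrite ler_norml; lra.
Qed.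

Lemma uniform_limit_cvg (F : nat -> Delta -> R) c a :
  uniform_limit F c -> F N a @[N --> \oo] --> c.
Proof.
move=> Fc; apply/cvgrPdist_le => e e0; have [N0 N0P] := Fc e e0.
by exists N0 => // N /= NN; rewrite distrC N0P.
Qed.

Section stationary_distribution.
Hypothesis cesaro_flat : forall f, continuous f ->
  exists c, uniform_limit (fun N => cesaro_op Mf N f) c.

Let L f : R := limn (fun N => cesaro_op Mf N f point).

Let Lunif f : continuous f -> uniform_limit (fun N => cesaro_op Mf N f) (L f).
Proof.
move=> /cesaro_flat[c fc].
by rewrite /L (cvg_lim _ (uniform_limit_cvg point fc)).
Qed.

Let Lcvg f : continuous f -> cesaro_op Mf N f point @[N --> \oo] --> L f.
Proof. by move=> cf; exact: (uniform_limit_cvg point (Lunif cf)). Qed.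

Let LD f g : continuous f -> continuous g -> L (fun a => f a + g a) = L f + L g.
Proof.
move=> cf cg; apply: cvg_lim => //.
rewrite (_ : (fun N => _) =
    fun N => cesaro_op Mf N f point + cesaro_op Mf N g point).
  by apply: cvgD; exact: Lcvg.
apply/funext => N; rewrite /cesaro_op -mulrDr -big_split; congr (_ * _).
by apply: eq_bigr => k _; rewrite iter_alpha_opD.
Qed.

Let LZ c f : continuous f -> L (fun a => c * f a) = c * L f.
Proof.
move=> cf; apply: cvg_lim => //.
rewrite (_ : (fun N => _) = fun N => c * cesaro_op Mf N f point).
  by apply: cvgMl_tmp; exact: Lcvg.
apply/funext => N; rewrite /cesaro_op mulrCA [in RHS]mulr_sumr; congr (_ * _).
by apply: eq_bigr => k _; rewrite iter_alpha_opZ.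
Qed.

Let L_ge0 f : continuous f -> (forall a, 0 <= f a) -> 0 <= L f.
Proof.
move=> cf f0; apply: limr_ge; first by apply: cvgP; exact: Lcvg.
apply: nearW => N; rewrite mulr_ge0// sumr_ge0// => k _.
exact: iter_alpha_op_ge0.
Qed.

Let L1 : L (fun=> 1) = 1.
Proof.
apply: cvg_lim => //; apply: cvg_near_cst; exists 1%N => // N /= N1.
apply/eqP; rewrite eq_le andbC; apply: cesaro_itv => // a.
by rewrite lexx.
Qed.

Let LT f : continuous f -> L (T f) = L f.
Proof.
move=> cf; have [B B0 fB] : exists2 B : R, 0 <= B & forall a, `|f a| <= B :=
  continuous_bounded_Delta cf.
apply: (@subr0_eq R); have cTf := continuous_alpha_op Mf_ge0 Mf_markov cf.
have /cvg_unique : cesaro_op Mf N (T f) point - cesaro_op Mf N f point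
    @[N --> \oo] --> L (T f) - L f by apply: cvgB; exact: Lcvg.
apply => //; apply/cvgr0Pnorm_le => e e0.
exists (Num.truncn (2 * B / e)).+1 => // N /= Ne.
apply: le_trans (cesaro_shift Mf_ge0 Mf_markov N 1 point fB) _.
have N0 : 0 < N%:R :> R by rewrite ltr0n (leq_trans _ Ne).
rewrite mul1r ler_pdivrMr// [e * _]mulrC -ler_pdivrMr//.
by rewrite (le_trans (ltW (truncnS_gt _)))// ler_nat.
Qed.

Lemma unique_ergodicity : exists lambda : probability Delta R,
  [/\ stationary Mf lambda,
      forall nu, stationary Mf nu -> nu ≡μ lambda,
      forall f mu, continuous f ->
        \int[mu]_a cesaro_op Mf N f a @[N --> \oo] --> \int[lambda]_a f a
    & forall f, continuous f -> \int[lambda]_a T f a = \int[lambda]_a f a].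
Proof.
have [lambda lamE] := riesz_representation LD LZ L_ge0 L1.
have inv f : continuous f -> \int[lambda]_a T f a = \int[lambda]_a f a.
  by move=> cf; rewrite !lamE// ?LT//; exact: continuous_alpha_op.
have lim f mu : continuous f ->
    \int[mu]_a cesaro_op Mf N f a @[N --> \oo] --> \int[lambda]_a f a.
  move=> cf; rewrite lamE//; apply: (uniform_limit_integral mu _ (Lunif cf)).
  by move=> N; exact: continuous_cesaro_op.
exists lambda; split => //.
  apply: probability_eq_continuous => f cf.
  by rewrite (alpha_adjointP Mf_ge0 Mf_markov)// inv.
move=> nu st; apply: probability_eq_continuous => f cf.
apply: (cvg_unique _ _ (lim f nu cf)) => //.
have inu k : \int[nu]_a iter k T f a = \int[nu]_a f a.
  elim: k => // k IH; rewrite -IH; apply: (stationary_integral st).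
  exact: continuous_iter_alpha_op.
apply: cvg_near_cst; exists 1%N => // N /= N1.
rewrite integral_cesaro_op//; under eq_bigr do rewrite inu.
rewrite sumr_const card_ord -[Rintegral _ _ _ *+ N]mulr_natl mulrA mulVf ?mul1r//.
by rewrite pnatr_eq0 -lt0n.
Qed.

End stationary_distribution.
End ErgodicTheorem.

Theorem theorem2 (R : realType) (n : nat) (Y : finType)
    (M : 'M[R]_n.+1) (Mf : Y -> 'M[R]_n.+1)
    (Y_nonempty : (0 < #|Y|)%N)
    (M_markov : markov_mx M)
    (Mf_ge0 : forall y, nonneg_mx (Mf y))
    (Mf_sum : \sum_y Mf y = M)
    (M_irreducible : irreducible_mx M)
    (cone_rank1 : exists2 A : 'M[R]_n.+1, closure (mx_cone Mf) A & \rank A = 1%N) :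
  exists lambda : probability (Delta R n) R,
    [/\ stationary Mf lambda,
        forall nu : probability (Delta R n) R, stationary Mf nu -> nu ≡μ lambda,
        forall mu : probability (Delta R n) R,
          weak_cvg (cesaro_mean (fun k => iter k (alpha_adjoint Mf) mu)) lambda
      & aperiodic_mx M -> forall mu : probability (Delta R n) R,
          weak_cvg (fun k => iter k (alpha_adjoint Mf) mu) lambda].
Proof.
subst M; have flat f := irreducible_cesaro_limit Mf_ge0 M_markov M_irreducible cone_rank1 (f := f).
have [lambda [st uniq lim inv]] := unique_ergodicity Mf_ge0 M_markov flat.
exists lambda; split => // [mu f cf|aper mu f cf].
  have := lim f mu cf.
  have -> // : (fun N => \int[mu]_a cesaro_op Mf N f a) = fun N =>
      \int[cesaro_mean (fun k => iter k (alpha_adjoint Mf) mu) N]_a f a.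
  apply/funext => N; rewrite integral_cesaro_mean// integral_cesaro_op//.
  by congr (_ * _); apply: eq_bigr => k _; rewrite integral_iter_adjoint.
have [c fc] := aperiodic_iter_limit Mf_ge0 M_markov aper cone_rank1 cf.
have cit N : continuous (iter N (alpha_op Mf) f) by exact: continuous_iter_alpha_op.
have -> : \int[lambda]_a f a = c.
  apply: (cvg_unique _ _ (uniform_limit_integral lambda cit fc)) => //.
  apply: cvg_near_cst; apply: nearW => N.
  by elim: N => // N IH; rewrite -IH -[RHS]inv.
have := uniform_limit_integral mu cit fc.
have -> // : (fun N => \int[mu]_a iter N (alpha_op Mf) f a) = fun N =>
    \int[iter N (alpha_adjoint Mf) mu]_a f a.
by apply/funext => N; rewrite integral_iter_adjoint.
Qed.
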